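(* Let $G$ be a finite simple undirected graph of order $n$ with $e(G)$ edges, and let $1\le k\le n$. Then $$s_k(G)=e(G)+\binom{k+1}{2}$$ if and only if $G\in\mathcal{G}_{k,r,s}$ for some integers $r\ge 1$ and $s\ge 0$; i.e., if and only if $G$ is a threshold graph with clique number $k+1$.
   Context: All graphs are finite, simple and undirected. For a graph $G$ of order $n$, $L(G)$ is its Laplacian matrix (diagonal matrix of vertex degrees minus adjacency matrix), with eigenvalues $\lambda_1(G)\ge\lambda_2(G)\ge\cdots\ge\lambda_n(G)=0$, and $s_k(G)=\sum_{i=1}^k\lambda_i(G)$ for $1\le k\le n$. $N(v)$ denotes the set of neighbours of a vertex $v$. The family $\mathcal{G}_{k,r,s}$ consists of all graphs $G$ whose vertex set admits a partition $V(G)=U\sqcup R\sqcup S$, where $U$ is a clique of order $k$, $R$ and $S$ are independent sets with $|R|=r\ge 1$ and $|S|=s\ge 0$, every vertex in $R$ is adjacent to every vertex of $U$, and the vertices of $S$ can be listed as $v_1,\dots,v_s$ so that $N(v_i)\subsetneq U$ for all $i$ and $N(v_{i+1})\subseteq N(v_i)$ for $1\le i<s$. (For fixed $k$, the union of these families over $r\ge1$, $s\ge0$ is exactly the class of threshold graphs with clique number $k+1$.) *)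

(* Defs.v *)
From HB Require Import structures.
From mathcomp Require Import all_boot all_order all_algebra.
From mathcomp Require Import reals.
From mathcomp Require Import spectral polyrcf complex.
Set Implicit Arguments.
Unset Strict Implicit.
Unset Printing Implicit Defensive.
Import Order.TTheory GRing.Theory Num.Theory.
Local Open Scope ring_scope.

(* A simple graph is given by a symmetric irreflexive relation [adj] on a
   finite type [T]; these two properties are hypotheses of the theorems, not
   part of the definitions below. *)

Definition nbr (T : finType) (adj : rel T) (x : T) : {set T} :=
  [set y | adj x y].

Definition edges (T : finType) (adj : rel T) : {set {set T}} :=
  [set e : {set T} | [exists x, exists y, adj x y && (e == [set x; y])]].

(* Vertices are identified with matrix indices along the enumeration of [T]. *)
Definition laplacian (R : realType) (T : finType) (adj : rel T) : 'M[R]_#|T| :=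
  diag_mx (\row_i #|nbr adj (enum_val i)|%:R)
  - \matrix_(i, j) (adj (enum_val i) (enum_val j))%:R.

(* Real eigenvalues listed with algebraic multiplicity, largest first; the list
   is exhaustive when [A] is symmetric, see [char_poly_eigenvalues]. *)
Definition eigenvalues (R : realType) (n : nat) (A : 'M[R]_n) : seq R :=
  let p := char_poly A in
  sort >=%R (flatten [seq nseq (mup x p) x | x <- rootsR p]).

Definition laplacian_sum (R : realType) (T : finType) (adj : rel T) (k : nat)
    : R :=
  \sum_(i < k) (eigenvalues (laplacian R adj))`_i.

Definition clique (T : finType) (adj : rel T) (A : {set T}) : bool :=
  [forall x in A, forall y in A, (x != y) ==> adj x y].

Definition clique_number (T : finType) (adj : rel T) : nat :=
  (\max_(A : {set T} | clique adj A) #|A|)%N.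

Definition independent (T : finType) (adj : rel T) (A : {set T}) : bool :=
  [forall x in A, forall y in A, ~~ adj x y].

(* [S] may be empty, so [partition] of finset, which bars empty blocks, does
   not apply.  The tuple [v] is the listing v_1, ..., v_s of [S], and [sorted]
   compares consecutive entries. *)
Definition in_family (T : finType) (adj : rel T) (k r s : nat) : Prop :=
  exists U Rs S : {set T},
    [/\ U :|: Rs :|: S = setT,
        [/\ [disjoint U & Rs], [disjoint U & S] & [disjoint Rs & S]],
        [/\ clique adj U, independent adj Rs & independent adj S],
        [/\ #|U| = k, #|Rs| = r & #|S| = s]
      & {in Rs & U, forall x y, adj x y} /\
        exists v : s.-tuple T,
          [/\ uniq v, v =i S, {in v, forall x, nbr adj x \proper U}
            & sorted (fun x y => nbr adj y \subset nbr adj x) v]].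

(* [threshold_seq adj l]: the subgraph induced on the vertices of [l] is built
   from the last vertex of [l] by successively adding, from right to left, an
   isolated or a dominating vertex. *)
Inductive threshold_seq (T : finType) (adj : rel T) : seq T -> Prop :=
| threshold_single x : threshold_seq adj [:: x]
| threshold_isolated x l : threshold_seq adj l -> x \notin l ->
    {in l, forall y, ~~ adj x y} -> threshold_seq adj (x :: l)
| threshold_dominating x l : threshold_seq adj l -> x \notin l ->
    {in l, forall y, adj x y} -> threshold_seq adj (x :: l).

Definition threshold (T : finType) (adj : rel T) : Prop :=
  exists l : seq T, threshold_seq adj l /\ forall x, x \in l.

Lemma eigenvalues_sorted (R : realType) n (A : 'M[R]_n) :
  sorted >=%R (eigenvalues A).
Proof. by apply: sort_sorted => x y; exact: le_total. Qed.

Lemma eigenvalues_perm (R : realType) n (A : 'M[R]_n) (s : seq R) :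
  char_poly A = \prod_(x <- s) ('X - x%:P) -> perm_eq (eigenvalues A) s.
Proof.
move=> ps; rewrite perm_sort; apply/allP => x _ /=; apply/eqP.
rewrite -(mu_prod_XsubC x s) -ps count_flatten -map_comp.
have p0 : char_poly A != 0 by rewrite monic_neq0 ?char_poly_monic.
rewrite (eq_map (g := fun y => (y == x) * mup y (char_poly A))%N); last first.
  by move=> y /=; rewrite count_nseq.
rewrite sumnE big_map; have [xr|xNr] := boolP (root (char_poly A) x).
  have xin : x \in rootsR (char_poly A).
    have := roots_on_rootsR p0 x; rewrite xr andbT => <-.
    by rewrite in_itv.
  rewrite (bigD1_seq x) ?uniq_roots//= eqxx mul1n big1 ?addn0 // => y.
  by move=> /negPf ->.
rewrite mupNroot // big1 // => y _; have [->|//] := eqVneq y x.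
by rewrite mupNroot.
Qed.

Lemma symmetric_char_poly_split (R : realType) n (A : 'M[R]_n) :
  A^T = A -> exists d : 'I_n -> R, char_poly A = \prod_i ('X - (d i)%:P).
Proof.
move=> symA; pose f := real_complex R; pose B : 'M[R[i]]_n := map_mx f A.
have hB : B \is hermsymmx.
  apply/is_hermitianmxP; rewrite expr0 scale1r.
  apply/matrixP => i j; rewrite !mxE -{1}symA mxE; apply/esym/CrealP.
  by apply/complex_realP; exists (A j i).
have /orthomx_spectralP Beq := hermitian_normalmx hB.
have dreal := hermitian_spectral_diag_real hB.
set P := spectralmx B in Beq; set D := spectral_diag B in Beq dreal.
have Pu : P \in unitmx := spectral_unit B.
have cpB : char_poly B = char_poly (diag_mx D).
  have e : char_poly_mx B =
      map_mx polyC (invmx P) *m char_poly_mx (diag_mx D) *m map_mx polyC P.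
    rewrite /char_poly_mx {1}Beq !map_mxM mulmxBr mulmxBl; congr (_ - _).
    by rewrite scalar_mxC -mulmxA -map_mxM mulVmx // map_mx1 mulmx1.
  rewrite /char_poly e !det_mulmx mulrAC -det_mulmx -map_mxM mulVmx //.
  by rewrite map_mx1 det1 mul1r.
exists (fun i => complex.Re (D 0 i)); apply: (map_poly_inj f).
rewrite rmorph_prod /= map_char_poly -/B cpB char_poly_trig; last first.
  exact/diag_mx_is_trig.
apply: eq_bigr => i _; rewrite rmorphB /= map_polyX map_polyC mxE eqxx mulr1n.
congr ('X - _%:P); apply/esym; apply: RRe_real; exact: (mxOverP dreal).
Qed.

Lemma char_poly_eigenvalues (R : realType) n (A : 'M[R]_n) :
  A^T = A -> char_poly A = \prod_(x <- eigenvalues A) ('X - x%:P).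
Proof.
move=> /symmetric_char_poly_split[d dE].
have E : char_poly A = \prod_(x <- codom d) ('X - x%:P).
  by rewrite dE codomE big_map big_enum.
by rewrite (perm_big _ (eigenvalues_perm E)).
Qed.

Lemma size_eigenvalues (R : realType) n (A : 'M[R]_n) :
  A^T = A -> size (eigenvalues A) = n.
Proof.
move=> /char_poly_eigenvalues E; apply/eqP; rewrite -eqSS.
by rewrite -(size_prod_XsubC _ id) -E size_char_poly.
Qed.

Lemma laplacian_sym (R : realType) (T : finType) (adj : rel T) :
  symmetric adj -> (laplacian R adj)^T = laplacian R adj.
Proof.
move=> adjC; rewrite linearB /= tr_diag_mx; congr (_ - _).
by apply/matrixP => i j; rewrite !mxE adjC.
Qed.

(* Main.v *)
Require Import Defs.
From HB Require Import structures.
From mathcomp Require Import all_boot all_order all_algebra.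
From mathcomp Require Import reals.
From mathcomp Require Import perm ring lra.
Set Implicit Arguments.
Unset Strict Implicit.
Unset Printing Implicit Defensive.
Import Order.TTheory GRing.Theory Num.Theory.
Local Open Scope ring_scope.

(** Let [P] be the orthogonal projection onto [k] top eigenvectors of the
    Laplacian orthogonal to the constants, [c x y] its entries, [a x] its diagonal
    and [t x y = a x + a y - 2 c x y], so that the sum of the [k] largest
    eigenvalues is the sum of [t] over the edges.  For a vertex set [U], complete
    [U] to a clique and erase the edges inside its complement.  The Grone-Merris
    bound for the resulting split graph says that the sum of [t] over its edges is
    at most [k #|U|] plus the number of edges leaving [U].  Averaging this over the
    level sets [U = {a > theta}], with [theta] uniform in [0, 1], gives
      [e + 'C(k + 1, 2) - s_k >= \sum_edges (c + 1 - max) ^ 2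
                                 + \sum_nonedges (c - min) ^ 2],
    where [max] and [min] are those of the two values of [a].  In the equality
    case all these squares vanish; the row of [P] at a vertex [v] maximizing [a] then
    shows that the non-neighbours of [v] are isolated, so that the graph has an
    isolated or a dominating vertex, which can be peeled off together with a
    rank-one part of [P].

    The split graph bound is proved, following Bai, on the invariant subspace of
    the top eigenvectors, written as the graph of [- X] over the clique.  Instead
    of showing that [X] is nonnegative, one compares the determinant
    [det (F (I; - X))], for [F] a matrix of eigenvectors, on all column-stochastic
    [X]: applying [1 + t R], where [R] is the Laplacian minus [#|U|], maps
    column-stochastic graphs to column-stochastic graphs and multiplies the
    determinant by [\prod (1 + t r_i)] up to the determinant of a Z-matrix. *)

(** * Column-dominant Z-matrices *)

(** Strictly column diagonally dominant matrices with nonpositive off-diagonal entries. They are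
    nonsingular M-matrices, hence the positivity and determinant bounds below. *)
Definition zmatrix (R : realType) n (A : 'M[R]_n) : Prop :=
  (forall i j, i != j -> A i j <= 0) /\ (forall j, 0 < \sum_i A i j).

Lemma zmatrix_diag_gt0 (R : realType) n (A : 'M[R]_n) i :
  zmatrix A -> 0 < A i i.
Proof.
case=> A_le0 /(_ i); rewrite (bigD1 i) //= => /lt_le_trans; apply.
by rewrite gerDl sumr_le0 // => j ji; exact: A_le0.
Qed.

(** Minimum principle: at an index [i] minimizing [y], a negative [y 0 i] would give
    [(y *m A) 0 i <= y 0 i * \sum_j A j i < 0]. *)
Lemma zmatrix_ge0 (R : realType) n (A : 'M[R]_n) (y : 'rV_n) :
  zmatrix A -> (forall j, 0 <= (y *m A) 0 j) -> forall j, 0 <= y 0 j.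
Proof.
move=> [A_le0 A_gt0] yA_ge0 j0.
case: (arg_minP (fun j => y 0 j) (erefl (xpredT j0))) => i _ imin.
apply: le_trans (imin j0 isT); rewrite leNgt; apply/negP => yi_lt0.
have := yA_ge0 i; rewrite leNgt => /negP; apply.
rewrite mxE; apply: (@le_lt_trans _ _ (\sum_j y 0 i * A j i)).
  apply: ler_sum => j _; have [->//|ji] := eqVneq j i.
  by apply: ler_wnM2r; [exact: A_le0|exact: imin].
by rewrite -mulr_sumr nmulr_rlt0.
Qed.

Lemma zmatrix_unit (R : realType) n (A : 'M[R]_n) : zmatrix A -> A \in unitmx.
Proof.
move=> zA; rewrite -row_free_unit -kermx_eq0; apply/rowV0P => y /sub_kermxP yA.
have y_ge0 : forall j, 0 <= y 0 j.
  by apply: (zmatrix_ge0 zA) => j; rewrite yA mxE.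
have y_le0 : forall j, 0 <= (- y) 0 j.
  by apply: (zmatrix_ge0 zA) => j; rewrite mulNmx yA oppr0 mxE.
apply/rowP => j; rewrite mxE; apply/eqP; rewrite eq_le y_ge0 andbT.
by have := y_le0 j; rewrite mxE oppr_ge0.
Qed.

Lemma det_block_schur (R : realType) n (a : R) (r : 'rV[R]_n) (c : 'cV[R]_n)
    (A : 'M[R]_n) : a != 0 ->
  \det (block_mx a%:M r c A : 'M_(1 + n)) = a * \det (A - a^-1 *: (c *m r)).
Proof.
move=> a0.
have -> : block_mx a%:M r c A =
    block_mx 1%:M 0 (a^-1 *: c) 1%:M *m
    block_mx (a%:M : 'M_1) r 0 (A - a^-1 *: (c *m r)).
  rewrite mulmx_block !mul1mx !mul0mx !addr0 -!scalemxAl.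
  rewrite scalar_mxC mul_scalar_mx scalerA mulVf // scale1r.
  by rewrite addrC subrK.
by rewrite det_mulmx det_lblock det_ublock !det1 !mul1r det_scalar expr1.
Qed.

(** Hadamard-type bound by elimination: the Schur complement of the first pivot is again a Z-matrix,
    and its diagonal is no larger, because what is subtracted is a product of two nonpositive
    entries over a positive pivot. *)
Lemma zmatrix_det_le (R : realType) n (A : 'M[R]_n) :
  zmatrix A -> `|\det A| <= \prod_i A i i.
Proof.
elim: n A => [|n IHn] A zA.
  by rewrite det_mx00 normr1 big_ord0.
have [A_le0 A_gt0] := zA; have a_gt0 := zmatrix_diag_gt0 ord0 zA.
set a := A ord0 ord0 in a_gt0.
pose A' : 'M_(1 + n) := A.
have ulA : ulsubmx A' = a%:M.
  by rewrite [LHS]mx11_scalar !mxE /a !lshift0.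
pose S := drsubmx A' - a^-1 *: (dlsubmx A' *m ursubmx A').
have SE i j : S i j = A (lift ord0 i) (lift ord0 j)
    - a^-1 * (A (lift ord0 i) ord0 * A ord0 (lift ord0 j)).
  by rewrite !mxE big_ord1 !mxE !rshift1 !lshift0.
have detA : \det A = a * \det S.
  by rewrite -[A]/(A' : 'M_n.+1) -{1}[A']submxK ulA det_block_schur ?gt_eqF.
have aV : 0 < a^-1 by rewrite invr_gt0.
have S_diag i : S i i <= A (lift ord0 i) (lift ord0 i).
  rewrite SE gerBl mulr_ge0 ?(ltW aV) // -mulrNN mulr_ge0 // oppr_ge0.
    by apply: A_le0.
  by apply: A_le0.
have zS : zmatrix S.
  split=> [i j ij|j].
    rewrite SE subr_le0; apply: le_trans (A_le0 _ _ _) _.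
      by apply: contra_neq ij; exact: lift_inj.
    by rewrite mulr_ge0 ?(ltW aV) // -mulrNN mulr_ge0 // oppr_ge0; apply: A_le0.
  under eq_bigr do rewrite SE.
  rewrite sumrB -mulr_sumr -mulr_suml.
  have := A_gt0 (lift ord0 j); rewrite big_ord_recl => Cj.
  have := A_gt0 ord0; rewrite big_ord_recl -/a => C0.
  have Aj_le0 : A ord0 (lift ord0 j) <= 0 by exact: A_le0.
  move: Cj C0 Aj_le0.
  set x := A ord0 _; set y := \sum_i _; set z := \sum_i _ => Cj C0 x_le0.
  apply: (lt_le_trans Cj); rewrite -subr_ge0.
  (* Elimination does not decrease column sums: the gain is the positive sum [a + z] of the pivot
     column times [- x / a]. *)
  have -> : y - a^-1 * (z * x) - (x + y) = a^-1 * ((a + z) * - x).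
    by field; rewrite gt_eqF.
  by rewrite mulr_ge0 ?(ltW aV) // mulr_ge0 ?oppr_ge0 // ltW.
rewrite detA normrM (gtr0_norm a_gt0) big_ord_recl -/a ler_pM2l //.
apply: le_trans (IHn _ zS) _; apply: ler_prod => i _.
by rewrite S_diag (ltW (zmatrix_diag_gt0 i zS)).
Qed.

(** * Polynomial perturbation and first-order comparison *)

(** A nonzero [p] cannot vanish at [size p] distinct points. The candidates are [e / (i + 2)], where
    the 2 keeps even the first one strictly below [e]. *)
Lemma nonroot_small (R : realType) (p : {poly R}) (e : R) :
  p != 0 -> 0 < e -> exists x, [/\ 0 < x, x < e & p.[x] != 0].
Proof.
move=> p0 e0; pose f (i : nat) : R := e / i.+2%:R.
have [/hasP[x /mapP[i _ ->] nr]|/hasPn allr] :=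
    boolP (has (fun x => ~~ root p x) [seq f i | i <- iota 0 (size p)]).
  exists (f i); split; last exact: nr.
    by rewrite divr_gt0.
  by rewrite ltr_pdivrMr // ltr_pMr // ltr1n.
have: (size [seq f i | i <- iota 0 (size p)] < size p)%N.
  apply: max_poly_roots => //.
    by apply/allP => x /allr; rewrite negbK.
  rewrite map_inj_uniq ?iota_uniq // => i j /(mulfI (lt0r_neq0 e0)) /invr_inj.
  by move=> /eqP; rewrite eqr_nat => /eqP[].
by rewrite size_map size_iota ltnn.
Qed.

Lemma det_affine_poly (R : realType) n (A B : 'M[R]_n) :
  exists q : {poly R}, forall x, q.[x] = \det (A + x *: B).
Proof.
exists (\det (map_mx polyC A + 'X *: map_mx polyC B)) => x.
rewrite -[LHS]/(horner_eval x _) -det_map_mx; congr (\det _).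
apply/matrixP => i j; rewrite !mxE /= /horner_eval hornerD hornerM hornerX !hornerC //.
Qed.

Lemma det_le_entries (R : realType) n (A : 'M[R]_n) K :
  (forall i j, `|A i j| <= K) -> `|\det A| <= n`!%:R * K ^+ n.
Proof.
move=> AK; apply: le_trans (ler_norm_sum _ _ _) _.
apply: (@le_trans _ _ (\sum_(s : 'S_n) K ^+ n)).
  apply: ler_sum => s _; rewrite normrM normrX normrN1 expr1n mul1r normr_prod.
  have -> : K ^+ n = \prod_(i < n) K by rewrite prodr_const card_ord.
  by apply: ler_prod => i _; rewrite normr_ge0 AK.
by rewrite sumr_const card_Sn mulr_natl.
Qed.

Lemma prod_first_order (R : realType) n (x : 'I_n -> R) :
  exists2 K, 0 <= K & forall t, 0 < t -> t <= 1 ->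
    `|\prod_i (1 + t * x i) - (1 + t * \sum_i x i)| <= K * t ^+ 2.
Proof.
elim: n x => [|n IHn] x.
  exists 0 => // t _ _; rewrite !big_ord0 mulr0 addr0 subrr normr0 mul0r //.
have [K K0 HK] := IHn (fun i => x (lift ord0 i)).
exists ((1 + `|x ord0|) * K + `|x ord0| * `|\sum_i x (lift ord0 i)|).
  by rewrite addr_ge0 // mulr_ge0 // addr_ge0.
move=> t t0 t1; rewrite !big_ord_recl.
have := HK t t0 t1; set p := \prod_i _; set s := \sum_i _; set y := x ord0.
move=> Hp.
have -> : (1 + t * y) * p - (1 + t * (y + s)) =
    (1 + t * y) * (p - (1 + t * s)) + y * s * t ^+ 2 by ring.
apply: le_trans (ler_normD _ _) _; rewrite [leRHS]mulrDl lerD //.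
  rewrite normrM -mulrA ler_pM //.
  apply: le_trans (ler_normD _ _) _; rewrite normr1 lerD2l normrM gtr0_norm //.
  by rewrite ler_piMl.
by rewrite normrM (ger0_norm (sqr_ge0 t)) normrM.
Qed.

(** As [t] tends to 0 the products agree with [1 + t * \sum_i x i] and [1 + t * \sum_i y i] up to an
    error quadratic in [t], so the linear terms must be ordered as well. *)
Lemma sum_le_of_prod_le (R : realType) n (x y : 'I_n -> R) e :
  0 < e -> (forall t, 0 < t -> t < e ->
    \prod_i (1 + t * x i) <= \prod_i (1 + t * y i)) ->
  \sum_i x i <= \sum_i y i.
Proof.
move=> e0 Hprod; rewrite leNgt; apply/negP => yx.
have [K K0 HK] := prod_first_order x; have [L L0 HL] := prod_first_order y.
set g := \sum_i x i - \sum_i y i.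
have g0 : 0 < g by rewrite subr_gt0.
(* Small enough for the quadratic errors [(K + L) * t ^+ 2] to stay below the linear gap [t * g]. *)
pose t := Num.min (Num.min (e / 2) 1) (g / (2 * (K + L + 1))).
have KL0 : 0 < 2 * (K + L + 1) by lra.
have t0 : 0 < t by rewrite !lt_min divr_gt0 //= divr_gt0 // ltr01.
have te : t < e.
  have : t <= e / 2 by rewrite /t !ge_min lexx.
  by move=> ?; lra.
have t1 : t <= 1 by rewrite /t !ge_min lexx orbT.
have tg : t * (2 * (K + L + 1)) <= g.
  by rewrite -ler_pdivlMr // /t ge_min lexx orbT.
have := Hprod t t0 te; have := HK t t0 t1; have := HL t t0 t1.
rewrite !ler_norml => /andP[_ L2] /andP[K1 _] P1.
have : t * g <= (K + L) * t ^+ 2 by rewrite /g; nra.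
rewrite expr2 mulrA mulrC -subr_ge0 -mulrBl pmulr_lge0 //; nra.
Qed.

(** * Eigenvalue sums of split graphs *)

(** Column sums equal to 1 say that the columns of [(I; - X)] are orthogonal to the constants. *)
Definition col_stochastic (R : realType) m n (X : 'M[R]_(m, n)) : Prop :=
  (forall i j, 0 <= X i j) /\ (forall j, \sum_i X i j = 1).

Lemma col_stochastic_le1 (R : realType) m n (X : 'M[R]_(m, n)) i j :
  col_stochastic X -> X i j <= 1.
Proof.
by case=> X_ge0 /(_ j) <-; rewrite (bigD1 i) //= lerDl sumr_ge0.
Qed.

Section SplitEigen.
Variables (R : realType) (N N' : nat) (B : 'M[R]_(N, N')).
Variables (FU : 'M[R]_N) (FW : 'M[R]_(N, N')) (r : 'rV[R]_N).
Hypothesis B01 : forall u w, 0 <= B u w <= 1.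
Hypothesis N'_gt0 : (0 < N')%N.
Let d : 'rV[R]_N := \row_u \sum_w B u w.
Let p : 'rV[R]_N' := \row_w \sum_u (1 - B u w).
Hypothesis eigU :
  FU *m (diag_mx d - const_mx 1) - FW *m B^T = diag_mx r *m FU.
Hypothesis eigW : - (FU *m B) - FW *m diag_mx p = diag_mx r *m FW.
Hypothesis F1 : FU *m const_mx 1 + FW *m const_mx 1 = 0 :> 'cV_N.
Hypothesis F_orth : FU *m FU^T + FW *m FW^T = 1%:M.

Let psi (X : 'M[R]_(N', N)) : R := \det (FU - FW *m X).
(** The clique block of [R (I; - X)], where [R] is the Laplacian of the split graph minus [N]. *)
Let M (X : 'M[R]_(N', N)) : 'M[R]_N := diag_mx d - const_mx 1 + B *m X.

Let BX_bounds (X : 'M[R]_(N', N)) (i j : 'I_N) : col_stochastic X -> 0 <= (B *m X) i j <= 1.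
Proof.
case=> X_ge0 X1; rewrite mxE; apply/andP; split.
  by rewrite sumr_ge0 // => w _; rewrite mulr_ge0 ?X_ge0 //; case/andP: (B01 i w).
rewrite -(X1 j); apply: ler_sum => w _; rewrite ler_piMl ?X_ge0 //.
by case/andP: (B01 i w).
Qed.

Let p_bounds w : 0 <= p 0 w <= N%:R.
Proof.
rewrite mxE; apply/andP; split.
  by rewrite sumr_ge0 // => u _; have := B01 u w; lra.
have -> : N%:R = \sum_(u < N) (1 : R) by rewrite sumr_const card_ord.
by apply: ler_sum => u _; have := B01 u w; lra.
Qed.

Let ItM (X : 'M_(N', N)) t (i j : 'I_N) : (1%:M + t *: M X : 'M[R]_N) i j =
  (i == j)%:R + t * (d 0 j *+ (i == j) - 1 + (B *m X) i j).
Proof.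
rewrite [LHS]mxE [in X in _ + X]mxE 2![in X in _ + _ * X]mxE; congr (_ + _ * (_ + _)).
  by rewrite mxE.
by rewrite !mxE; case: eqP => [->|].
Qed.

Let zmatrix_ItM X t : col_stochastic X -> 0 < t -> t * N%:R < 1 ->
  zmatrix (1%:M + t *: M X).
Proof.
move=> sX t0 tN; split=> [i j ij|j].
  rewrite ItM (negPf ij) mulr0n !add0r.
  have /andP[_ h] := BX_bounds i j sX; rewrite pmulr_rle0 //; lra.
under eq_bigr do rewrite ItM.
rewrite big_split /= -mulr_sumr big_split /= big_split /=.
rewrite sumr_const card_ord.
have -> : \sum_(i < N) (i == j)%:R = 1 :> R.
  by rewrite (bigD1 j) //= eqxx big1 ?addr0 // => i /negPf ->.
have -> : \sum_(i < N) d 0 j *+ (i == j) = d 0 j.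
  by rewrite (bigD1 j) //= eqxx big1 ?addr0 // => i /negPf ->.
have d0 : 0 <= d 0 j.
  by rewrite mxE sumr_ge0 // => w _; case/andP: (B01 j w).
have s0 : 0 <= \sum_i (B *m X) i j.
  by rewrite sumr_ge0 // => i _; case/andP: (BX_bounds i j sX).
rewrite mulNrn; nra.
Qed.

(** [1 + t R] maps [(I; - X)] to [(A; - C) = (I; - X') A], and [F (1 + t R) = (1 + t diag r) F];
    multiplying by [F] and taking determinants gives the identity. The bound on [t] makes [A] a
    Z-matrix and [C] nonnegative, so the rows of [X'] are nonnegative by the minimum principle. *)
Let step X t : col_stochastic X -> 0 < t -> t * N%:R < 1 ->
  exists2 X', col_stochastic X' &
    \prod_i (1 + t * r 0 i) * psi X = psi X' * \det (1%:M + t *: M X).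
Proof.
move=> sX t0 tN; have zA := zmatrix_ItM sX t0 tN.
set A := 1%:M + t *: M X in zA *; have uA := zmatrix_unit zA.
pose C := t *: B^T + X - t *: (diag_mx p *m X).
pose X' := C *m invmx A.
have X'A : X' *m A = C by rewrite mulmxKV.
have [X_ge0 X1] := sX.
have CE w u : C w u = t * B u w + X w u - t * (p 0 w * X w u).
  by rewrite /C mul_diag_mx !mxE.
have C_ge0 w u : 0 <= C w u.
  have /andP[p0 pN] := p_bounds w; have /andP[b0 _] := B01 u w.
  have x0 := X_ge0 w u; rewrite CE.
  have : t * p 0 w <= 1 by apply: le_trans (ltW tN); rewrite ler_pM2l.
  move: (mulr_ge0 (ltW t0) b0) => ? ?.
  have : t * p 0 w * X w u <= X w u by rewrite ler_piMl.
  by rewrite -mulrA; lra.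
exists X'.
  split=> [w u|u].
    have := @zmatrix_ge0 _ _ _ (row w X') zA.
    move=> /(_ _ u); rewrite mxE; apply => j.
    by rewrite -row_mul X'A mxE.
  (* [A] and [C] have the same column sums, since [1 + t R] preserves orthogonality to the
     constants. *)
  have : (const_mx 1 : 'rV_N') *m X' = const_mx 1.
    apply: (can_inj (mulmxK uA)); rewrite -mulmxA X'A.
    apply/rowP => j; rewrite !mxE.
    under eq_bigr do rewrite mxE mul1r CE.
    under [RHS]eq_bigr do rewrite mxE mul1r ItM.
    rewrite sumrB !big_split /= X1 -!mulr_sumr !big_split /=.
    rewrite sumr_const card_ord mulNrn.
    have -> : \sum_(i < N) (i == j)%:R = 1 :> R.
      by rewrite (bigD1 j) //= eqxx big1 ?addr0 // => i /negPf ->.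
    have -> : \sum_(i < N) d 0 j *+ (i == j) = d 0 j.
      by rewrite (bigD1 j) //= eqxx big1 ?addr0 // => i /negPf ->.
    have -> : \sum_w p 0 w * X w j = N%:R - \sum_i (B *m X) i j.
      have pE w : p 0 w = N%:R - \sum_u B u w.
        by rewrite mxE sumrB sumr_const card_ord.
      under eq_bigr do rewrite pE mulrBl.
      rewrite sumrB -mulr_sumr X1 mulr1; congr (_ - _).
      under [RHS]eq_bigr do rewrite mxE.
      by rewrite exchange_big /=; apply: eq_bigr => w _; rewrite mulr_suml.
    rewrite [d 0 j]mxE; ring.
  move=> /matrixP /(_ 0 u); rewrite !mxE => <-.
  by apply: eq_bigr => w _; rewrite [const_mx 1 _ _]mxE mul1r.
have -> : \prod_i (1 + t * r 0 i) = \det (1%:M + t *: diag_mx r).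
  have -> : 1%:M + t *: diag_mx r = diag_mx (const_mx 1 + t *: r).
    by apply/matrixP => i j; rewrite !mxE mulrnDl mulrnAr.
  by rewrite det_diag; apply: eq_bigr => i _; rewrite !mxE.
rewrite -!det_mulmx; congr (\det _).
rewrite [RHS]mulmxBl -mulmxA X'A /A /C /M.
have constX : (const_mx 1 : 'M_(N, N')) *m X = const_mx 1.
  apply/matrixP => i j; rewrite !mxE -[RHS](X1 j).
  by apply: eq_bigr => w _; rewrite mxE mul1r.
rewrite !mulmxDr !mulmxDl !mulmx1 !mul1mx -!scalemxAr -!scalemxAl mulmxDr.
have -> : FU *m (diag_mx d - const_mx 1) = diag_mx r *m FU + FW *m B^T.
  by rewrite -eigU subrK.
have -> : FU *m (B *m X) = - (FW *m diag_mx p *m X) - diag_mx r *m (FW *m X).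
  rewrite !mulmxA -eigW mulmxBl mulNmx.
  by rewrite opprB addrA addNr add0r opprK.
rewrite !mulmxN -!scalemxAr !mulmxA.
move: (diag_mx r *m FU) (FW *m B^T) (FW *m diag_mx p *m X)
  (diag_mx r *m FW *m X) (FW *m X) => Y1 Y2 Y3 Y4 Y5.
apply/matrixP => i j; rewrite !mxE; ring.
Qed.
(** For invertible [FU], the choice [X = - FW^T FU^-T] gives [psi X = 1 / \det FU] by
    orthonormality. In general [FU^T] is first shifted by a scalar matrix. The resulting [X] has
    column sums 1 but possibly negative entries, so it is finally pulled towards the uniform matrix
    [X0]. *)
Let psi_neq0 : exists2 X, col_stochastic X & psi X != 0.
Proof.
pose X0 : 'M[R]_(N', N) := const_mx N'%:R^-1.
have N'0 : 0 < N'%:R^-1 :> R by rewrite invr_gt0 ltr0n.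
have oneX0 : (const_mx 1 : 'rV_N') *m X0 = const_mx 1.
  apply/rowP => j; rewrite !mxE; under eq_bigr do rewrite !mxE mul1r.
  by rewrite sumr_const card_ord -[LHS]mulr_natr mulVf // pnatr_eq0 -lt0n.
have [q1 q1E] := det_affine_poly FU^T 1%:M.
have [q2 q2E] := det_affine_poly 1%:M (FU - FW *m X0).
have q1_neq0 : q1 != 0.
  have [q3 q3E] := det_affine_poly 1%:M FU^T.
  have q3_neq0 : q3 != 0.
    apply/eqP => q30; have := q3E 0; rewrite q30 horner0 scale0r addr0 det1.
    by move/eqP; rewrite eq_sym oner_eq0.
  have [x [x0 _ q3x]] := nonroot_small q3_neq0 ltr01.
  apply: contraNneq q3x => q10; rewrite q3E.
  have -> : 1%:M + x *: FU^T = x *: (FU^T + x^-1 *: 1%:M).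
    by rewrite scalerDr scalerA mulfV ?gt_eqF // scale1r addrC.
  by rewrite detZ -q1E q10 horner0 mulr0.
have q2_neq0 : q2 != 0.
  apply/eqP => q20; have := q2E 0; rewrite q20 horner0 scale0r addr0 det1.
  by move/eqP; rewrite eq_sym oner_eq0.
have [x [x0 _]] := nonroot_small (mulf_neq0 q1_neq0 q2_neq0) ltr01.
rewrite hornerM mulf_eq0 negb_or q1E q2E => /andP[GU_neq0 K_neq0].
set GU := FU^T + x *: 1%:M in GU_neq0.
have uG : GU \in unitmx by rewrite unitmxE unitfE.
(* The correction [x *: X0] balances the shift in [GU]: columns still sum to 1, and
   [(FU - FW X) GU = 1 + x (FU - FW X0)]. *)
pose X := - (FW^T - x *: X0) *m invmx GU.
have XG : X *m GU = - (FW^T - x *: X0) by rewrite mulmxKV.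
have psiX : psi X != 0.
  have -> : psi X = \det (1%:M + x *: (FU - FW *m X0)) * \det (invmx GU).
    rewrite /psi -det_mulmx; congr (\det _).
    apply: (can_inj (mulmxK uG)); rewrite mulmxKV // mulmxBl -mulmxA XG /GU.
    rewrite mulmxDr mulmxN mulmxBr -!scalemxAr mulmx1 opprK.
    rewrite -F_orth scalerBr.
    move: (FU *m FU^T) (FW *m FW^T) (FW *m X0) => Y1 Y2 Y3.
    by apply/matrixP => i j; rewrite !mxE; ring.
  by rewrite mulf_neq0 // det_inv invr_eq0.
have oneX : (const_mx 1 : 'rV_N') *m X = const_mx 1.
  apply: (can_inj (mulmxK uG)); rewrite -mulmxA XG mulmxN mulmxBr -scalemxAr oneX0.
  rewrite /GU mulmxDr -scalemxAr mulmx1.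
  have /(congr1 trmx) : FU *m (const_mx 1 : 'cV_N) = - (FW *m const_mx 1).
    by apply/eqP; rewrite -subr_eq0 opprK F1.
  rewrite linearN /= !trmx_mul !trmx_const => ->.
  by rewrite opprB addrC.
(* On the line through [X0] and [X], [psi] is a polynomial that is nonzero at [X]; hence it is
   nonzero at points arbitrarily close to [X0], whose entries are all positive. *)
have [q qE] := det_affine_poly (FU - FW *m X0) (- (FW *m (X - X0))).
have psi_line y : psi (X0 + y *: (X - X0)) = q.[y].
  rewrite qE; congr (\det _).
  by rewrite [in LHS]mulmxDr -scalemxAr scalerN opprD addrA.
have q_neq0 : q != 0.
  apply: contraNneq psiX => q0.
  by have := psi_line 1; rewrite scale1r addrC subrK q0 horner0 => ->.
pose S := \sum_i \sum_j `|(X - X0) i j|.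
have S_ge i j : `|(X - X0) i j| <= S.
  rewrite /S (bigD1 i) //= (bigD1 j) //= -addrA lerDl addr_ge0 //.
    by rewrite sumr_ge0.
  by rewrite sumr_ge0 // => ? _; rewrite sumr_ge0.
have S0 : 0 <= S by rewrite sumr_ge0 // => ? _; rewrite sumr_ge0.
have e0 : 0 < N'%:R^-1 / (1 + S) by rewrite divr_gt0 // ltr_wpDr.
have [y [y0 ye qy]] := nonroot_small q_neq0 e0.
exists (X0 + y *: (X - X0)); last by rewrite psi_line.
split=> [i j|j].
  have := S_ge i j; rewrite ler_norml => /andP[h _].
  have : y * (1 + S) < N'%:R^-1 by rewrite -ltr_pdivlMr // ltr_wpDr.
  have -> : (X0 + y *: (X - X0)) i j = N'%:R^-1 + y * (X - X0) i j.
    by rewrite mxE [const_mx _ _ _]mxE [(y *: (X - X0) : 'M[R]_(N', N)) i j]mxE.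
  nra.
have colE (Y : 'M[R]_(N', N)) : \sum_i Y i j = ((const_mx 1 : 'rV_N') *m Y) 0 j.
  by rewrite mxE; apply: eq_bigr => i _; rewrite [const_mx 1 _ _]mxE mul1r.
rewrite colE mulmxDr -scalemxAr mulmxBr oneX oneX0 subrr scaler0 addr0.
by rewrite mxE.
Qed.

(** A step multiplies [|psi|] by at least [C / D], because the determinant of [1 + t M] is bounded
    by its diagonal, hence by [D]. If [C > D], a near-maximizer of [|psi|] would be pushed beyond
    the supremum. So [C <= D] for all small [t], and the linear terms in [t] give the bound. *)
Lemma split_eigen_sum : \sum_i r 0 i <= \sum_u \sum_w B u w.
Proof.
pose E (y : R) : Prop := exists2 X, col_stochastic X & `|psi X| = y.
have [Z sZ psiZ] := psi_neq0.
pose K : R := 1 + \sum_i \sum_j `|FU i j| + \sum_i \sum_j `|FW i j|.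
have EK X : col_stochastic X -> `|psi X| <= N`!%:R * K ^+ N.
  move=> sX; apply: det_le_entries => i j; rewrite mxE.
  apply: le_trans (ler_normD _ _) _; rewrite /K; apply: lerD.
    set S := \sum_i _.
    have : `|FU i j| <= S; last by lra.
    rewrite /S (bigD1 i) //= (bigD1 j) //= -addrA lerDl addr_ge0 //.
      by rewrite sumr_ge0.
    by rewrite sumr_ge0 // => ? _; rewrite sumr_ge0.
  rewrite mxE normrN mxE; apply: le_trans (ler_norm_sum _ _ _) _.
  apply: (@le_trans _ _ (\sum_w `|FW i w|)).
    apply: ler_sum => w _; rewrite normrM ler_piMr //.
    by have [X_ge0 _] := sX; rewrite ger0_norm // col_stochastic_le1.
  by rewrite [leRHS](bigD1 i) //= lerDl sumr_ge0 // => ? _; rewrite sumr_ge0.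
have supE : classical_sets.has_sup E.
  split; first by exists `|psi Z|, Z.
  by exists (N`!%:R * K ^+ N) => _ [X sX <-]; exact: EK.
have E_le X : col_stochastic X -> `|psi X| <= sup E.
  by move=> sX; apply: sup_upper_bound => //; exists X.
have s0 : 0 < sup E by apply: lt_le_trans (E_le _ sZ); rewrite normr_gt0.
have d_ge0 i : 0 <= d 0 i.
  by rewrite mxE sumr_ge0 // => w _; case/andP: (B01 i w).
suff /sum_le_of_prod_le : forall t, 0 < t -> t < N.+1%:R^-1 ->
    \prod_i (1 + t * r 0 i) <= \prod_i (1 + t * d 0 i).
  have N0 : 0 < N.+1%:R^-1 :> R by rewrite invr_gt0.
  move=> /(_ N0); under [leRHS]eq_bigr do rewrite mxE; exact.
move=> t t0 tN; rewrite leNgt; apply/negP.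
set C := \prod_i (1 + t * r 0 i); set D := \prod_i (1 + t * d 0 i) => DC.
have D0 : 0 < D.
  by apply: prodr_gt0 => i _; rewrite ltr_wpDr // mulr_ge0 // ltW.
have C0 : 0 < C by exact: lt_trans DC.
have tN1 : t * N%:R < 1.
  apply: (@le_lt_trans _ _ (t * N.+1%:R)).
    by rewrite ler_pM2l // ler_nat.
  by rewrite -ltr_pdivlMr // div1r.
(* With this tolerance the near-maximizer satisfies [|psi X| > sup E * (D / C)]. *)
have e0 : 0 < sup E * (1 - D / C).
  by rewrite mulr_gt0 // subr_gt0 ltr_pdivrMr // mul1r.
have [_ [X sX <-]] := sup_adherent e0 supE.
rewrite mulrBr mulr1 opprB addrCA subrr addr0 => sX'.
have [X' sX'' eqX] := step sX t0 tN1.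
have : C * `|psi X| <= sup E * D.
  rewrite -(gtr0_norm C0) -normrM eqX normrM ler_pM //; first exact: E_le.
  apply: le_trans (zmatrix_det_le (zmatrix_ItM sX t0 tN1)) _.
  apply: ler_prod => i _; rewrite (ltW (zmatrix_diag_gt0 i (zmatrix_ItM sX t0 tN1))).
  rewrite ItM eqxx mulr1n lerD2l ler_pM2l //.
  have /andP[_ ?] := BX_bounds i i sX.
  by rewrite -addrA gerDl addrC subr_le0.
by rewrite mulrC -ler_pdivlMr // leNgt -mulrA sX'.
Qed.
End SplitEigen.

(** * Orthonormal eigenbases of real symmetric matrices *)

Lemma row_sqr_sum (R : realType) n (v : 'rV[R]_n) :
  v *m v^T = (\sum_i v 0 i ^+ 2)%:M.
Proof.
apply/matrixP => i j; rewrite !ord1 !mxE eqxx mulr1n.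
by apply: eq_bigr => l _; rewrite mxE expr2.
Qed.

Lemma row_sqr_eq0 (R : realType) n (v : 'rV[R]_n) : v *m v^T = 0 -> v = 0.
Proof.
rewrite row_sqr_sum => /matrixP /(_ 0 0); rewrite !mxE eqxx mulr1n => /eqP.
rewrite psumr_eq0 => [/allP v0|i _]; last exact: sqr_ge0.
apply/rowP => i; rewrite mxE; apply/eqP.
by have := v0 i (mem_index_enum _); rewrite sqrf_eq0.
Qed.

(** The Householder reflection that exchanges [v] with the first basis vector is orthogonal with
    first row [v]; its other rows form [F]. When [v] already is that basis vector, the identity
    serves instead. *)
Lemma orthonormal_complement (R : realType) n (v : 'rV[R]_n.+1) :
  v *m v^T = 1%:M -> exists F : 'M[R]_(n, n.+1),
    [/\ F *m F^T = 1%:M, F *m v^T = 0 & v^T *m v + F^T *m F = 1%:M].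
Proof.
move=> v1.
suff [H HH Hv] : exists2 H : 'M[R]_(1 + n), H *m H^T = 1%:M & usubmx H = v.
  have HtH : H^T *m H = 1%:M by exact: mulmx1C.
  have HE : H = col_mx v (dsubmx H) by rewrite -Hv vsubmxK.
  have HtE : H^T = row_mx v^T (dsubmx H)^T by rewrite {1}HE tr_col_mx.
  exists (dsubmx H); split; last by rewrite -mul_row_col -HtE -HE.
    have := congr1 drsubmx HH; rewrite HtE {1}HE mul_col_row block_mxKdr => ->.
    by apply/matrixP => i j; rewrite !mxE.
  have := congr1 dlsubmx HH; rewrite HtE {1}HE mul_col_row block_mxKdl => ->.
  by apply/matrixP => i j; rewrite !mxE eq_rlshift.
pose e0 : 'rV[R]_(1 + n) := row_mx 1%:M 0.
have e01 : e0 *m e0^T = 1%:M.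
  by rewrite tr_row_mx mul_row_col trmx0 mulmx0 addr0 trmx1 mul1mx.
pose w : 'rV[R]_(1 + n) := v - e0.
have usubE (A : 'M[R]_(1 + n)) : usubmx A = e0 *m A.
  by rewrite -{2}[A]vsubmxK mul_row_col mul1mx mul0mx addr0.
have [w0|w_neq0] := eqVneq w 0.
  exists 1%:M; first by rewrite trmx1 mulmx1.
  by rewrite usubE mulmx1; apply/esym/eqP; rewrite -subr_eq0 -/w w0.
set s := \sum_i w 0 i ^+ 2.
have ww : w *m w^T = s%:M by exact: row_sqr_sum.
have s0 : s != 0.
  apply: contraNneq w_neq0 => s0; apply/eqP/row_sqr_eq0.
  by rewrite ww s0; apply/matrixP => i j; rewrite !mxE mul0rn.
pose H := 1%:M - (2 / s) *: (w^T *m w).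
have Ht : H^T = H by rewrite linearB /= linearZ /= trmx_mul trmxK trmx1.
exists H.
  rewrite Ht {1}/H mulmxBl mul1mx {2}/H mulmxBr mulmx1 -scalemxAl -scalemxAr.
  rewrite -mulmxA (mulmxA w) ww mul_scalar_mx -scalemxAr !scalerA.
  rewrite /H; move: (w^T *m w) => Y; apply/matrixP => i j; rewrite !mxE; field.
  done.
rewrite usubE /H mulmxBr mulmx1 -scalemxAr mulmxA.
have ev : e0 *m v^T = v *m e0^T.
  apply/matrixP => i j; rewrite !ord1 [LHS]mxE [RHS]mxE.
  by apply: eq_bigr => l _; rewrite [v^T _ _]mxE [e0^T _ _]mxE mulrC.
have -> : e0 *m w^T = (- (s / 2))%:M.
  have : w *m w^T = - (e0 *m w^T) *+ 2.
    have vw : v *m w^T = - (e0 *m w^T).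
      by rewrite /w linearB /= !mulmxBr v1 e01 -ev opprB.
    by rewrite {1}/w mulmxBl vw mulr2n.
  rewrite ww => /matrixP /(_ 0 0); rewrite mxE eqxx mulr1n => sE.
  apply/matrixP => i j; rewrite !ord1 [RHS]mxE eqxx mulr1n sE.
  by set a := e0 *m w^T; rewrite mulr2n [in RHS]mxE [in RHS]mxE; field.
rewrite mul_scalar_mx scalerA.
have -> : 2 / s * - (s / 2) = -1 by field.
by rewrite scaleN1r opprK /w addrC subrK.
Qed.

Lemma orthonormal_mul (R : realType) m n l (F : 'M[R]_(m, n)) (G : 'M_(l, m)) :
  F *m F^T = 1%:M -> G *m G^T = 1%:M -> (G *m F) *m (G *m F)^T = 1%:M.
Proof. by move=> F1 G1; rewrite trmx_mul -mulmxA (mulmxA F) F1 mul1mx. Qed.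

(** The complement of an eigenvector is invariant, so eigenvectors of the compression [F A F^T] pull
    back along [F] to eigenvectors of [A]. *)
Lemma symmetric_deflation (R : realType) n (A : 'M[R]_n.+1) (v : 'rV_n.+1) a :
  A^T = A -> v *m v^T = 1%:M -> v *m A = a *: v ->
  (forall A' : 'M[R]_n, A'^T = A' -> exists (G : 'M[R]_n) (d : 'rV_n),
    G *m G^T = 1%:M /\ G *m A' = diag_mx d *m G) ->
  exists (F : 'M[R]_(n, n.+1)) (d : 'rV_n),
    [/\ F *m F^T = 1%:M, F *m v^T = 0, v^T *m v + F^T *m F = 1%:M &
        F *m A = diag_mx d *m F].
Proof.
move=> symA v1 vA IH; have [F [FF Fv vF]] := orthonormal_complement v1.
have Av : A *m v^T = a *: v^T.
  by apply: trmx_inj; rewrite trmx_mul trmxK symA vA linearZ /= trmxK.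
have [|G [d [GG GA]]] := IH (F *m A *m F^T).
  by rewrite !trmx_mul trmxK symA mulmxA.
exists (G *m F), d; split.
- exact: orthonormal_mul.
- by rewrite -mulmxA Fv mulmx0.
- by rewrite trmx_mul -mulmxA (mulmxA _ G) (mulmx1C GG) mul1mx.
have FAE : F *m A *m F^T *m F = F *m A.
  rewrite -mulmxA -[RHS]mulmx1 -vF mulmxDr [X in _ = X + _](_ : _ = 0) ?add0r //.
  by rewrite mulmxA -(mulmxA F) Av -scalemxAr Fv scaler0 mul0mx.
by rewrite [RHS]mulmxA -GA -[RHS]mulmxA FAE [RHS]mulmxA.
Qed.

Lemma symmetric_diagonalizable (R : realType) n (A : 'M[R]_n) :
  A^T = A -> exists (F : 'M[R]_n) (d : 'rV_n),
    F *m F^T = 1%:M /\ F *m A = diag_mx d *m F.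
Proof.
elim: n A => [|n IHn] A symA.
  by exists 1%:M, 0; split; apply/matrixP => -[].
have [d dE] := symmetric_char_poly_split symA.
have : eigenvalue A (d ord0).
  by rewrite eigenvalue_root_char dE big_ord_recl rootM root_XsubC eqxx.
move=> /eigenvalueP[w wA w0].
set s := \sum_i w 0 i ^+ 2.
have ww : w *m w^T = s%:M by exact: row_sqr_sum.
have s_gt0 : 0 < s.
  rewrite lt_neqAle sumr_ge0 ?andbT => [|i _]; last exact: sqr_ge0.
  apply: contraNneq w0 => s0; apply/eqP/row_sqr_eq0.
  by rewrite ww -s0; apply/matrixP => i j; rewrite !mxE mul0rn.
pose v := (Num.sqrt s)^-1 *: w.
have v1 : v *m v^T = 1%:M.
  rewrite linearZ /= -scalemxAl -scalemxAr ww scalerA -invfM -expr2 sqr_sqrtr ?ltW //.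
  by rewrite scale_scalar_mx mulVf // gt_eqF.
have vA : v *m A = d ord0 *: v.
  by rewrite -scalemxAl wA !scalerA mulrC.
have [F [c [FF Fv vF FA]]] := symmetric_deflation symA v1 vA IHn.
have vF0 : v *m F^T = 0 by apply: trmx_inj; rewrite trmx_mul trmxK Fv trmx0.
pose O : 'M[R]_(1 + n, n.+1) := col_mx v F.
pose e : 'rV[R]_(1 + n) := row_mx (const_mx (d ord0)) c.
have OO : O *m O^T = 1%:M.
  by rewrite /O tr_col_mx mul_col_row v1 vF0 Fv FF scalar_mx_block.
have OA : O *m A = diag_mx e *m O.
  rewrite /O /e mul_col_mx vA FA diag_mx_row mul_block_col !mul0mx addr0 add0r.
  congr col_mx; rewrite -mul_scalar_mx; congr (_ *m _).
  by apply/matrixP => i j; rewrite !ord1 !mxE.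
by exists O, e.
Qed.

(** Deflation at the normalized constant vector. Leaving that vector out keeps the eigenbasis
    orthogonal to the constants even when the eigenvalue [a] is multiple. *)
Lemma centered_eigenbasis (R : realType) n (A : 'M[R]_n.+1) a :
  A^T = A -> (const_mx 1 : 'rV_n.+1) *m A = a *: const_mx 1 ->
  exists (F : 'M[R]_(n, n.+1)) (d : 'rV_n),
    [/\ F *m F^T = 1%:M, F *m const_mx 1 = 0 :> 'cV_n,
        F^T *m F = 1%:M - const_mx n.+1%:R^-1 &
        F *m A = diag_mx d *m F].
Proof.
move=> symA oneA; pose s : R := Num.sqrt n.+1%:R.
have s_gt0 : 0 < s by rewrite sqrtr_gt0.
have ss : s * s = n.+1%:R by rewrite -expr2 sqr_sqrtr.
pose v : 'rV[R]_n.+1 := s^-1 *: const_mx 1.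
have v1 : v *m v^T = 1%:M.
  rewrite row_sqr_sum; congr _%:M; under eq_bigr do rewrite !mxE mulr1.
  by rewrite sumr_const card_ord -[LHS]mulr_natr -ss expr2 -invfM mulVf // mulf_neq0 // gt_eqF.
have vA : v *m A = a *: v by rewrite -scalemxAl oneA !scalerA mulrC.
have [F [d [FF Fv vF FA]]] :=
  symmetric_deflation symA v1 vA (@symmetric_diagonalizable R n).
exists F, d; split => //.
  have : s *: (F *m v^T) = 0 by rewrite Fv scaler0.
  rewrite scalemxAr -[s *: v^T]linearZ /= scalerA mulfV ?gt_eqF // scale1r.
  by rewrite trmx_const.
have vv : v^T *m v = const_mx n.+1%:R^-1.
  by apply/matrixP => i j; rewrite !mxE big_ord1 !mxE !mulr1 -invfM ss.
by rewrite -vF vv [RHS]addrC addKr.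
Qed.

(** Stacking the constant row on [F] gives a matrix [O] that conjugates [A] to a diagonal one; [O]
    is invertible because [O O^T] is diagonal with nonzero entries. *)
Lemma char_poly_centered (R : realType) n (A : 'M[R]_n.+1) a F d :
  A^T = A -> (const_mx 1 : 'rV_n.+1) *m A = a *: const_mx 1 ->
  F *m F^T = 1%:M -> F *m const_mx 1 = 0 :> 'cV_n ->
  F *m A = diag_mx d *m F ->
  char_poly A = ('X - a%:P) * \prod_i ('X - (d 0 i)%:P).
Proof.
move=> symA oneA FF F1 FA.
pose O : 'M[R]_(1 + n, n.+1) := col_mx (const_mx 1) F.
pose e : 'rV[R]_(1 + n) := row_mx a%:M d.
have OA : O *m A = diag_mx e *m O.
  rewrite /O /e mul_col_mx oneA FA diag_mx_row mul_block_col !mul0mx addr0 add0r.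
  congr col_mx; rewrite -mul_scalar_mx; congr (_ *m _).
  by apply/matrixP => i j; rewrite !ord1 !mxE.
have OO : O *m O^T = block_mx n.+1%:R%:M 0 0 1%:M.
  rewrite /O tr_col_mx mul_col_row FF trmx_const F1; congr block_mx.
    apply/matrixP => i j; rewrite !ord1 !mxE eqxx mulr1n.
    by under eq_bigr do rewrite !mxE mulr1; rewrite sumr_const card_ord.
  apply: trmx_inj; rewrite trmx_mul trmxK trmx_const F1 trmx0 //.
have O_neq0 : \det O != 0.
  have : \det (O *m O^T) != 0.
    by rewrite OO det_ublock det_scalar1 det1 mulr1 pnatr_eq0.
  by rewrite det_mulmx mulf_eq0 negb_or => /andP[].
have : map_mx polyC O *m char_poly_mx A = char_poly_mx (diag_mx e) *m map_mx polyC O.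
  rewrite /char_poly_mx mulmxBr mulmxBl -!map_mxM OA; congr (_ - _).
  by rewrite scalar_mxC.
move/(congr1 determinant); rewrite !det_mulmx mulrC => /mulIf E.
rewrite /char_poly E ?det_map_mx ?polyC_eq0 //.
rewrite -/(char_poly _) char_poly_trig ?diag_mx_is_trig // big_ord_recl.
congr (_ * _); first by rewrite !mxE eqxx mulr1n; case: splitP => // j _; rewrite ord1 !mxE.
apply: eq_bigr => i _; rewrite !mxE eqxx mulr1n.
case: splitP => [j|j] /=; first by rewrite ord1.
by rewrite /bump !add1n => -[ij]; congr (_ - (d 0 _)%:P); apply: val_inj.
Qed.

(** * The Grone-Merris bound for split graphs *)

Lemma exists_set_between (T : finType) (A B : {set T}) m :
  A \subset B -> (#|A| <= m <= #|B|)%N ->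
  exists C : {set T}, [/\ A \subset C, C \subset B & #|C| = m].
Proof.
move=> AB /andP[Am mB]; have [q mE] : exists q, m = (#|A| + q)%N.
  by exists (m - #|A|)%N; rewrite subnKC.
elim: q A AB Am mE => [|q IHq] A AB Am mE.
  by exists A; rewrite subxx mE addn0.
have /subsetPn[x xB xA] : ~~ (B \subset A).
  apply: contraTN mB => /subset_leq_card BA; rewrite -ltnNge mE addnS ltnS.
  by apply: leq_trans BA _; rewrite leq_addr.
have cx : #|x |: A| = #|A|.+1 by rewrite cardsU1 xA.
have [||| C [xAC CB Cm]] := IHq (x |: A).
- by apply/subsetP => y /setU1P[->//|]; exact: (subsetP AB).
- by rewrite cx mE addnS ltnS leq_addr.
- by rewrite cx mE addnS.
by exists C; split=> //; apply: subset_trans xAC; apply: subsetUr.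
Qed.

Lemma gram_diag_ge0 (R : realType) m n (A : 'M[R]_(m, n)) i :
  0 <= (A *m A^T) i i.
Proof. by rewrite mxE sumr_ge0 // => j _; rewrite mxE -expr2 sqr_ge0. Qed.

Section RowSelection.
Variables (R : realType) (m n : nat) (F : 'M[R]_(m, n)) (S : 'M[R]_n).
Variable r : 'rV[R]_m.
Hypotheses (FF : F *m F^T = 1%:M) (FS : F *m S = diag_mx r *m F).

Lemma rowsub_orth q (h : 'I_q -> 'I_m) : injective h ->
  rowsub h F *m (rowsub h F)^T = 1%:M.
Proof.
move=> h_inj; apply/matrixP => i j; rewrite !mxE.
have := congr1 (fun M : 'M_m => M (h i) (h j)) FF; rewrite !mxE.
under eq_bigr do rewrite mxE.
by under [in X in _ -> X]eq_bigr do rewrite !mxE; rewrite (inj_eq h_inj).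
Qed.

Lemma rowsub_eigen q (h : 'I_q -> 'I_m) :
  rowsub h F *m S = diag_mx (\row_i r 0 (h i)) *m rowsub h F.
Proof.
apply/matrixP => i j; rewrite mul_diag_mx !mxE.
have := congr1 (fun M : 'M_(m, n) => M (h i) j) FS; rewrite mul_diag_mx !mxE => <-.
by apply: eq_bigr => l _; rewrite mxE.
Qed.
End RowSelection.

Section SplitTrace.
Variables (R : realType) (N N' : nat) (B : 'M[R]_(N, N')).
Hypothesis B01 : forall u w, 0 <= B u w <= 1.
Let d : 'rV[R]_N := \row_u \sum_w B u w.
Let p : 'rV[R]_N' := \row_w \sum_u (1 - B u w).

(* The Laplacian of the split graph minus [N] times the identity. *)
Definition split_mx : 'M[R]_(N + N') :=
  block_mx (diag_mx d - const_mx 1) (- B) (- B^T) (- diag_mx p).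
Local Notation S := split_mx.

Lemma mul_split_mx q (G : 'M[R]_(q, N + N')) :
  G *m S = row_mx (lsubmx G *m (diag_mx d - const_mx 1) - rsubmx G *m B^T)
                  (- (lsubmx G *m B) - rsubmx G *m diag_mx p).
Proof.
by rewrite -{1}[G]hsubmxK mul_row_block !mulmxN.
Qed.

(** With more than [N] such eigenvectors, a nonzero combination would vanish on the clique; there
    the quadratic form reduces to [- diag p], which is never positive. *)
Lemma split_eigen_pos q (G : 'M[R]_(q, N + N')) (r : 'rV_q) :
  G *m G^T = 1%:M -> G *m S = diag_mx r *m G ->
  (forall i, 0 < r 0 i) -> (q <= N)%N.
Proof.
move=> GG GS r_gt0; rewrite leqNgt; apply/negP => Nq.
have : kermx (lsubmx G) != 0.
  rewrite -mxrank_eq0 mxrank_ker subn_eq0 -ltnNge.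
  exact: leq_ltn_trans (rank_leq_col _) Nq.
case/rowV0Pn => y /sub_kermxP yG y0.
have yGE : y *m G = row_mx 0 (y *m rsubmx G).
  by rewrite -{1}[G]hsubmxK mul_mx_row yG.
move: (y *m rsubmx G) yGE => z yGE.
have E1 : (y *m G) *m S *m (y *m G)^T = \sum_i (r 0 i * y 0 i ^+ 2)%:M.
  rewrite -(mulmxA y) GS trmx_mul !mulmxA -(mulmxA _ G) GG mulmx1.
  rewrite mul_mx_diag; apply/matrixP => i j; rewrite !ord1 mxE summxE.
  by apply: eq_bigr => l _; rewrite !mxE eqxx mulr1n; ring.
have E2 : (y *m G) *m S *m (y *m G)^T =
    \sum_w (- (p 0 w * z 0 w ^+ 2))%:M.
  rewrite mul_split_mx yGE row_mxKl row_mxKr !mul0mx tr_row_mx trmx0.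
  rewrite mul_row_col mulmx0 add0r oppr0 add0r mul_mx_diag.
  apply/matrixP => i j; rewrite !ord1 mxE summxE.
  by apply: eq_bigr => l _; rewrite [in RHS]mxE eqxx mulr1n [z^T _ _]mxE mxE [_ l]mxE; ring.
have : \sum_i r 0 i * y 0 i ^+ 2 <= 0.
  have := congr1 (fun M : 'M_1 => M 0 0) (esym E1); rewrite E2 !summxE.
  under eq_bigr do rewrite mxE eqxx mulr1n; move=> ->.
  apply: sumr_le0 => w _; rewrite mxE eqxx mulr1n oppr_le0 mulr_ge0 ?sqr_ge0 //.
  by rewrite mxE sumr_ge0 // => u _; have := B01 u w; lra.
have [i yi] : exists i, y 0 i != 0.
  apply/existsP; apply: contraNT y0; rewrite negb_exists => /forallP y0.
  by apply/eqP/rowP => i; rewrite mxE; apply/eqP; rewrite -[_ == _]negbK.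
rewrite (bigD1 i) //= leNgt ltr_wpDr //.
  by rewrite sumr_ge0 // => j _; rewrite mulr_ge0 ?sqr_ge0 // ltW.
by rewrite mulr_gt0 // exprn_even_gt0.
Qed.
(** Dually, a combination supported on the clique has entries summing to zero, so the all-ones block
    drops out and the form reduces to [diag d], which is never negative. *)
Lemma split_eigen_neg q (G : 'M[R]_(q, N + N')) (r : 'rV_q) :
  G *m G^T = 1%:M -> G *m S = diag_mx r *m G -> G *m const_mx 1 = 0 :> 'cV_q ->
  (forall i, r 0 i < 0) -> (q <= N')%N.
Proof.
move=> GG GS G1 r_lt0; rewrite leqNgt; apply/negP => Nq.
have : kermx (rsubmx G) != 0.
  rewrite -mxrank_eq0 mxrank_ker subn_eq0 -ltnNge.
  exact: leq_ltn_trans (rank_leq_col _) Nq.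
case/rowV0Pn => y /sub_kermxP yG y0.
have yGE : y *m G = row_mx (y *m lsubmx G) 0.
  by rewrite -{1}[G]hsubmxK mul_mx_row yG.
move: (y *m lsubmx G) yGE => z yGE.
have z1 : \sum_u z 0 u = 0.
  have : y *m G *m (const_mx 1 : 'cV_(N + N')) = 0 by rewrite -mulmxA G1 mulmx0.
  rewrite yGE -col_mx_const mul_row_col mul0mx addr0 => /matrixP /(_ 0 0).
  by rewrite !mxE => {2}<-; apply: eq_bigr => u _; rewrite mxE mulr1.
have E1 : (y *m G) *m S *m (y *m G)^T = \sum_i (r 0 i * y 0 i ^+ 2)%:M.
  rewrite -(mulmxA y) GS trmx_mul !mulmxA -(mulmxA _ G) GG mulmx1.
  rewrite mul_mx_diag; apply/matrixP => i j; rewrite !ord1 mxE summxE.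
  by apply: eq_bigr => l _; rewrite !mxE eqxx mulr1n; ring.
have E2 : (y *m G) *m S *m (y *m G)^T = \sum_u (d 0 u * z 0 u ^+ 2)%:M.
  rewrite mul_split_mx yGE row_mxKl row_mxKr !mul0mx !subr0 tr_row_mx trmx0.
  rewrite mul_row_col mulmx0 addr0 mulmxBr [X in _ - X](_ : _ = 0) ?subr0.
    rewrite mul_mx_diag; apply/matrixP => i j; rewrite !ord1 mxE summxE.
    by apply: eq_bigr => l _; rewrite [in RHS]mxE eqxx mulr1n [z^T _ _]mxE [_ l]mxE; ring.
  apply/matrixP => i j; rewrite !mxE !ord1 -[RHS]z1.
  by apply: eq_bigr => l _; rewrite mxE mulr1.
have : 0 <= \sum_i r 0 i * y 0 i ^+ 2.
  have := congr1 (fun M : 'M_1 => M 0 0) (esym E1); rewrite E2 !summxE.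
  under eq_bigr do rewrite mxE eqxx mulr1n; move=> ->.
  apply: sumr_ge0 => u _; rewrite mxE eqxx mulr1n mulr_ge0 ?sqr_ge0 //.
  by rewrite mxE sumr_ge0 // => w _; have /andP[] := B01 u w.
have [i yi] : exists i, y 0 i != 0.
  apply/existsP; apply: contraNT y0; rewrite negb_exists => /forallP y0.
  by apply/eqP/rowP => i; rewrite mxE; apply/eqP; rewrite -[_ == _]negbK.
rewrite (bigD1 i) //= leNgt ltr_wnDr //.
  by rewrite sumr_le0 // => j _; rewrite mulr_le0_ge0 ?sqr_ge0 // ltW.
by rewrite nmulr_rlt0 // exprn_even_gt0.
Qed.

Lemma split_sum_pos (G : 'M[R]_(N, N + N')) (r : 'rV_N) : (0 < N')%N ->
  G *m G^T = 1%:M -> G *m S = diag_mx r *m G -> G *m const_mx 1 = 0 :> 'cV_N ->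
  \sum_i r 0 i <= \sum_u \sum_w B u w.
Proof.
move=> N'0 GG GS G1.
have : G *m S = row_mx (diag_mx r *m lsubmx G) (diag_mx r *m rsubmx G).
  by rewrite GS -mul_mx_row hsubmxK.
rewrite mul_split_mx => /eq_row_mx[eU eW].
apply: (split_eigen_sum B01 N'0 eU eW).
  by rewrite -mul_row_col hsubmxK col_mx_const.
by rewrite -mul_row_col -tr_row_mx hsubmxK.
Qed.

(** The complement of a split graph is a split graph with the two parts exchanged and
    [B' = 1 - B^T]. On vectors orthogonal to the constants its shifted Laplacian is the negative of
    the original one, so [split_eigen_sum] applies with eigenvalues [- r]. *)
Lemma split_sum_neg (G : 'M[R]_(N', N + N')) (r : 'rV_N') : (0 < N)%N ->
  G *m G^T = 1%:M -> G *m S = diag_mx r *m G -> G *m const_mx 1 = 0 :> 'cV_N' ->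
  - \sum_i r 0 i <= \sum_u \sum_w (1 - B u w).
Proof.
move=> N0 GG GS G1.
have : G *m S = row_mx (diag_mx r *m lsubmx G) (diag_mx r *m rsubmx G).
  by rewrite GS -mul_mx_row hsubmxK.
rewrite mul_split_mx => /eq_row_mx[eU eW].
pose B' : 'M[R]_(N', N) := \matrix_(w, u) (1 - B u w).
have B'01 w u : 0 <= B' w u <= 1 by rewrite mxE; have := B01 u w; lra.
have G1' : rsubmx G *m const_mx 1 + lsubmx G *m const_mx 1 = 0 :> 'cV_N'.
  by rewrite addrC -mul_row_col hsubmxK col_mx_const.
(* The rows of [G] sum to zero, so an all-ones block on one part can be traded for minus the one on
   the other part. *)
have GUJ q : rsubmx G *m (const_mx 1 : 'M_(N', q)) =
    - (lsubmx G *m (const_mx 1 : 'M_(N, q))).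
  apply/matrixP => i j; have := congr1 (fun M : 'cV_N' => M i 0) G1'.
  rewrite !mxE => /eqP; rewrite addr_eq0 => /eqP e.
  transitivity (\sum_j rsubmx G i j * const_mx 1 j (0 : 'I_1)).
    by apply: eq_bigr => l _; rewrite !mxE.
  by rewrite e; congr (- _); apply: eq_bigr => l _; rewrite !mxE.
have := @split_eigen_sum _ _ _ B' (rsubmx G) (lsubmx G) (- r) B'01 N0.
have dE : \row_w \sum_u B' w u = p.
  by apply/rowP => w; rewrite !mxE; apply: eq_bigr => u _; rewrite mxE.
have pE : \row_u \sum_w (1 - B' w u) = d.
  by apply/rowP => w; rewrite !mxE; apply: eq_bigr => u _; rewrite mxE opprB addrC subrK.
have B'E : B' = const_mx 1 - B^T by apply/matrixP => w u; rewrite !mxE.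
rewrite dE pE.
have -> : diag_mx (- r) = - diag_mx r by rewrite linearN.
have -> : \sum_i (- r) 0 i = - \sum_i r 0 i.
  by rewrite -sumrN; apply: eq_bigr => i _; rewrite mxE.
have -> : \sum_w \sum_u B' w u = \sum_u \sum_w (1 - B u w).
  rewrite exchange_big; apply: eq_bigr => u _; apply: eq_bigr => w _.
  by rewrite mxE.
apply => //.
- rewrite mulmxBr GUJ mulNmx -eW B'E linearB /= trmxK trmx_const mulmxBr.
  move: (lsubmx G *m B) (lsubmx G *m const_mx 1) (rsubmx G *m diag_mx p) => Y1 Y2 Y3.
  by apply/matrixP => i j; rewrite !mxE; ring.
- rewrite mulNmx -eU B'E mulmxBr GUJ mulmxBr.
  move: (lsubmx G *m diag_mx d) (lsubmx G *m const_mx 1) (rsubmx G *m B^T) => Y1 Y2 Y3.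
  by apply/matrixP => i j; rewrite !mxE; ring.
by rewrite addrC -mul_row_col -tr_row_mx hsubmxK.
Qed.
End SplitTrace.

Section TraceEigenbasis.
Variables (R : realType) (n : nat) (F : 'M[R]_(n, n.+1)) (A P : 'M[R]_n.+1).
Variable r : 'rV[R]_n.
Hypotheses (FF : F *m F^T = 1%:M) (FA : F *m A = diag_mx r *m F).
Hypothesis FtF : F^T *m F = 1%:M - const_mx n.+1%:R^-1.
Hypotheses (symP : P^T = P) (PP : P *m P = P) (P1 : P *m const_mx 1 = 0 :> 'cV_n.+1).

Lemma centered_mul_const m (x : R) : P *m const_mx x = 0 :> 'M_(n.+1, m).
Proof.
apply/matrixP => i j; have := congr1 (fun M : 'cV_n.+1 => M i 0) P1.
rewrite !mxE; under eq_bigr do rewrite mxE mulr1; move=> e.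
by under eq_bigr do rewrite mxE; rewrite -mulr_suml e mul0r.
Qed.

(** The diagonal of [F P F^T] acts as a fractional selection of eigenvalues: by the next lemmas its
    entries lie in [0, 1] and sum to the trace of [P]. *)
Lemma trace_eigenbasis : \tr (P *m A) = \sum_i r 0 i * (F *m P *m F^T) i i.
Proof.
have PF : P *m (F^T *m F) = P.
  by rewrite FtF mulmxBr mulmx1 centered_mul_const subr0.
have -> : P *m A = (P *m F^T) *m (diag_mx r *m F).
  by rewrite -FA -{1}PF !mulmxA.
rewrite mxtrace_mulC.
have -> : diag_mx r *m F *m (P *m F^T) = diag_mx r *m (F *m P *m F^T).
  by rewrite !mulmxA.
rewrite mul_diag_mx; by apply: eq_bigr => i _; rewrite mxE.
Qed.

Lemma eigenbasis_weight_ge0 i : 0 <= (F *m P *m F^T) i i.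
Proof.
have -> : F *m P *m F^T = (F *m P) *m (F *m P)^T.
  by rewrite trmx_mul symP !mulmxA -(mulmxA F P P) PP.
exact: gram_diag_ge0.
Qed.

Lemma eigenbasis_weight_le1 i : (F *m P *m F^T) i i <= 1.
Proof.
rewrite -subr_ge0.
have -> : 1 - (F *m P *m F^T) i i = (F *m (1%:M - P) *m F^T) i i.
  rewrite mulmxBr mulmx1 mulmxBl FF; move: (F *m P *m F^T) => Y.
  by rewrite !mxE eqxx.
have Qt : (1%:M - P)^T = 1%:M - P by rewrite linearB /= trmx1 symP.
have QQ : (1%:M - P) *m (1%:M - P) = 1%:M - P.
  by rewrite mulmxBl mul1mx mulmxBr mulmx1 PP subrr subr0.
have -> : F *m (1%:M - P) *m F^T = (F *m (1%:M - P)) *m (F *m (1%:M - P))^T.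
  by rewrite trmx_mul Qt mulmxA -(mulmxA F (1%:M - P) (1%:M - P)) QQ.
exact: gram_diag_ge0.
Qed.

Lemma eigenbasis_weight_sum : \sum_i (F *m P *m F^T) i i = \tr P.
Proof.
rewrite -/(mxtrace _) mxtrace_mulC mulmxA FtF mulmxBl mul1mx linearB /=.
rewrite [X in _ - X](_ : _ = 0) ?subr0 //.
rewrite -[LHS]mxtrace_tr trmx_mul symP trmx_const centered_mul_const.
exact: mxtrace0.
Qed.

(** The subtracted term is the Rayleigh quotient of the constant vector, the one direction missing
    from [F]. *)
Lemma eigenvalue_sum : \sum_i r 0 i = \tr A - (\sum_i \sum_j A i j) / n.+1%:R.
Proof.
have -> : \sum_i r 0 i = \tr (F *m A *m F^T).
  by rewrite FA -mulmxA FF mulmx1 mxtrace_diag.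
rewrite mxtrace_mulC mulmxA FtF mulmxBl mul1mx linearB /=; congr (_ - _).
rewrite /mxtrace mulr_suml; under [RHS]eq_bigr do rewrite mulr_suml.
rewrite [RHS]exchange_big /=; apply: eq_bigr => i _.
by rewrite mxE; apply: eq_bigr => j _; rewrite mxE mulrC.
Qed.
End TraceEigenbasis.

(** The trace is at most the sum of the positive eigenvalues, of which there are at most [N.+1]. If
    there are exactly [N.+1], [split_sum_pos] bounds their sum; otherwise the remaining eigenvalues
    are bounded by [split_sum_neg] and subtracted from the total. *)
Lemma split_trace_le (R : realType) N N' (B : 'M[R]_(N.+1, N'.+1))
    (P : 'M[R]_(N.+1 + N'.+1)) :
  (forall u w, 0 <= B u w <= 1) -> P^T = P -> P *m P = P ->
  P *m const_mx 1 = 0 :> 'cV_(N.+1 + N'.+1) ->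
  \tr (P *m split_mx B) <= \sum_u \sum_w B u w.
Proof.
move=> B01 symP PP P1; set S := split_mx B; set n := (N + N'.+1)%N.
have symS : S^T = S.
  rewrite /S /split_mx tr_block_mx !linearN /= linearB /= trmx_const trmxK.
  by rewrite !tr_diag_mx.
have trS : \tr S = \sum_u \sum_w B u w - \sum_u \sum_w (1 - B u w) - N.+1%:R.
  rewrite /S /split_mx mxtrace_block linearB linearN /= !mxtrace_diag.
  rewrite [X in _ - X + _](_ : _ = N.+1%:R); last first.
    by rewrite /mxtrace; under eq_bigr do rewrite mxE; rewrite sumr_const card_ord.
  rewrite [\sum_u \sum_w (1 - B u w)]exchange_big /= addrAC.
  by congr (_ - _ - _); apply: eq_bigr => i _; rewrite mxE.
have oneS : (const_mx 1 : 'rV_(N.+1 + N'.+1)) *m S = (- N.+1%:R) *: const_mx 1.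
  rewrite mul_split_mx -row_mx_const row_mxKl row_mxKr scale_row_mx; congr row_mx.
    apply/rowP => j; rewrite mulmxBr mul_mx_diag !mxE !mul1r.
    rewrite [X in _ - X - _](_ : _ = N.+1%:R); last first.
      by under eq_bigr do rewrite !mxE mulr1; rewrite sumr_const card_ord.
    rewrite [X in _ - X = _](_ : _ = \sum_w B j w); last first.
      by apply: eq_bigr => w _; rewrite !mxE mul1r.
    by ring.
  apply/rowP => j; rewrite mul_mx_diag !mxE mul1r mulr1.
  under eq_bigr do rewrite !mxE mul1r.
  by rewrite -opprD -big_split /=; under eq_bigr do rewrite addrC subrK; rewrite sumr_const card_ord.
have [F [r [FF F1 FtF FS]]] := @centered_eigenbasis R n S _ symS oneS.
rewrite (trace_eigenbasis FS FtF P1).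
pose Tp := [set i | 0 < r 0 i]; pose Tn := [set i | r 0 i < 0].
have le_Tp : \sum_i r 0 i * (F *m P *m F^T) i i <= \sum_(i in Tp) r 0 i.
  rewrite [leRHS]big_mkcond; apply: ler_sum => i _; rewrite inE.
  have w0 := eigenbasis_weight_ge0 F symP PP i.
  have w1 := eigenbasis_weight_le1 FF symP PP i.
  by case: ltP => r0; [rewrite ler_piMr // ltW|rewrite mulr_le0_ge0].
apply: le_trans le_Tp _.
have selF q (h : 'I_q -> 'I_n) : injective h ->
    [/\ rowsub h F *m (rowsub h F)^T = 1%:M,
        rowsub h F *m S = diag_mx (\row_i r 0 (h i)) *m rowsub h F &
        rowsub h F *m const_mx 1 = 0 :> 'cV_q].
  move=> h_inj; split; [exact: rowsub_orth|exact: rowsub_eigen|].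
  apply/matrixP => i j; have := congr1 (fun M : 'cV_n => M (h i) 0) F1.
  by rewrite !mxE => e; rewrite -[RHS]e; apply: eq_bigr => l _; rewrite !mxE.
have Tp_le : (#|Tp| <= N.+1)%N.
  have [GG GS _] := selF _ _ (@enum_val_inj _ (mem Tp)).
  apply: (split_eigen_pos B01 GG GS) => i; rewrite mxE.
  by have := enum_valP i; rewrite inE.
have Tn_le : (#|Tn| <= N'.+1)%N.
  have [GG GS G1] := selF _ _ (@enum_val_inj _ (mem Tn)).
  apply: (split_eigen_neg B01 GG GS G1) => i; rewrite mxE.
  by have := enum_valP i; rewrite inE.
have sum_sel q (T : {set 'I_n}) (Tq : #|T| = q) : exists2 h : 'I_q -> 'I_n,
    injective h & \sum_i r 0 (h i) = \sum_(i in T) r 0 i.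
  case: q / Tq; exists enum_val; first exact: enum_val_inj.
  by rewrite -(big_enum_val (fun i => r 0 i)).
have [Tp_eq|Tp_neq] := eqVneq #|Tp| N.+1.
  have [h h_inj <-] := sum_sel _ _ Tp_eq; have [GG GS G1] := selF _ h h_inj.
  have := split_sum_pos B01 (ltn0Sn N') GG GS G1.
  by under eq_bigr do rewrite mxE.
have Tnp : Tn \subset ~: Tp.
  by apply/subsetP => i; rewrite !inE -leNgt => /ltW.
have cTp : (#|~: Tp| = n - #|Tp|)%N by rewrite cardsCs setCK card_ord.
(* With at most [N] positive eigenvalues among [n = N + N'.+1], the negative ones can be padded with
   zeros to exactly the [N'.+1] that [split_sum_neg] requires. *)
have [|C [TnC CTp cC]] := exists_set_between (m := N'.+1) Tnp.
  have p_le : (#|Tp| <= N)%N by rewrite -ltnS ltn_neqAle Tp_neq.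
  by rewrite Tn_le cTp; apply: leq_trans (leq_sub2l _ p_le); rewrite addKn.
have [h h_inj hE] := sum_sel _ _ cC; have [GG GS G1] := selF _ h h_inj.
have := split_sum_neg B01 (ltn0Sn N) GG GS G1.
under eq_bigr do rewrite mxE; rewrite hE => leC.
have sumE : \sum_i r 0 i = \sum_(i in Tp) r 0 i + \sum_(i in C) r 0 i.
  rewrite (bigID (mem Tp)) /=; congr (_ + _).
  rewrite (bigID (mem C)) /= [X in _ + X]big1 ?addr0 => [|i /andP[iTp iC]].
    apply: eq_bigl => i; rewrite andbC; case: (boolP (i \in C)) => //= iC.
    by have := subsetP CTp i iC; rewrite inE.
  apply/eqP; rewrite eq_le; move: iTp; rewrite inE -leNgt => -> /=.
  by rewrite leNgt; apply: contra iC => ri; apply: (subsetP TnC); rewrite inE.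
have sumS : \sum_i r 0 i = \sum_u \sum_w B u w - \sum_u \sum_w (1 - B u w).
  rewrite (eigenvalue_sum FF FS FtF).
  have -> : \sum_i \sum_j S i j = - (N.+1%:R * n.+1%:R).
    rewrite exchange_big /=.
    have colS j : \sum_i S i j = - N.+1%:R.
      have := congr1 (fun M : 'rV_(N.+1 + N'.+1) => M 0 j) oneS; rewrite [RHS]mxE.
      rewrite [const_mx 1 _ _ in X in _ = X -> _]mxE mulr1 => <-.
      by rewrite mxE; apply: eq_bigr => i _; rewrite [const_mx 1 _ _]mxE mul1r.
    under eq_bigr do rewrite colS.
    by rewrite sumr_const card_ord mulNrn mulr_natr.
  rewrite mulNr opprK mulfK ?pnatr_eq0 //.
  by move: trS; rewrite /S => ->; rewrite subrK.
lra.
Qed.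

(** * Averaging over level sets *)

(** The entries of an orthogonal projection that kills the constants, indexed by vertices so that
    subsets need no enumeration. *)
Definition centered_proj (R : realType) (T : finType) (c : T -> T -> R) : Prop :=
  [/\ forall x y, c x y = c y x,
      forall x y, \sum_z c x z * c z y = c x y
    & forall x, \sum_y c x y = 0].

(** The squared distance between the projections of the basis vectors at [x] and [y]; summed over
    the edges it gives the trace of the projection against the Laplacian. *)
Definition sqdist (R : realType) (T : finType) (c : T -> T -> R) x y : R :=
  c x x + c y y - 2 * c x y.

(** Layer-cake formula: [a x] and [min (a x) (a y)] are the integrals over the level of the
    indicators that [x], respectively both [x] and [y], lie above it. The integral is replaced by an
    induction on the support of [a]. *)
Lemma level_average (R : realType) (T : finType) (b : T -> R) (g : T -> T -> R) :
  (forall U : {set T},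
     0 <= \sum_(x in U) b x + \sum_(x in U) \sum_(y in U) g x y) ->
  forall a : T -> R, (forall x, 0 <= a x) ->
  0 <= \sum_x b x * a x + \sum_x \sum_y g x y * Num.min (a x) (a y).
Proof.
move=> bg a; have [m] := ubnP #|[set x | a x != 0]|.
elim: m a => // m IHm a lt_m a_ge0.
set U := [set x | a x != 0] in lt_m.
have a0 x : x \notin U -> a x = 0 by rewrite inE negbK => /eqP.
have [U0|[x0 x0U]] := set_0Vmem U.
  have aE x : a x = 0 by apply: a0; rewrite U0 inE.
  rewrite big1 ?add0r => [|x _]; last by rewrite aE mulr0.
  rewrite big1 // => x _; rewrite big1 // => y _.
  by rewrite !aE minxx mulr0.
case: (@arg_minP _ R _ x0 (mem U) a x0U) => i iU' imin; set e := a i.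
have iU : i \in U by [].
have ai : a i != 0 by move: iU; rewrite inE.
have e_gt0 : 0 < e by rewrite lt_neqAle a_ge0 eq_sym andbT.
(* Removing the least nonzero value [e] from the whole support [U] shrinks the support and lowers
   each minimum by [e] exactly on the pairs inside [U]. *)
pose a' x := a x - e *+ (x \in U).
have a'_ge0 x : 0 <= a' x.
  rewrite /a'; case: (boolP (x \in U)) => [/imin|/a0 ->]; first by rewrite subr_ge0.
  by rewrite subr0.
have lt_m' : (#|[set x | a' x != 0%R]| < m)%N.
  rewrite -ltnS; apply: leq_trans lt_m; rewrite ltnS; apply: proper_card.
  apply/properP; split.
    apply/subsetP => x; rewrite !inE; apply: contraNN => /eqP ax.
    by rewrite /a' inE ax eqxx subrr.
  by exists i => //; rewrite inE /a' iU subrr eqxx.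
have := addr_ge0 (mulr_ge0 (ltW e_gt0) (bg U)) (IHm a' lt_m' a'_ge0).
have aE x : a x = a' x + e *+ (x \in U) by rewrite subrK.
have minE x y : Num.min (a x) (a y) =
    Num.min (a' x) (a' y) + e *+ ((x \in U) && (y \in U)).
  case: (boolP (x \in U)) => xU; case: (boolP (y \in U)) => yU /=.
  - by rewrite !aE xU yU /= addr_minl.
  - rewrite (a0 y yU) (_ : a' y = 0) ?addr0; last by rewrite /a' (negPf yU) subr0 a0.
    by rewrite !min_r.
  - rewrite (a0 x xU) (_ : a' x = 0) ?addr0; last by rewrite /a' (negPf xU) subr0 a0.
    by rewrite !min_l.
  - by rewrite addr0 /a' (negPf xU) (negPf yU) !subr0.
suff -> : e * (\sum_(x in U) b x + \sum_(x in U) \sum_(y in U) g x y)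
  + (\sum_x b x * a' x + \sum_x \sum_y g x y * Num.min (a' x) (a' y)) =
  \sum_x b x * a x + \sum_x \sum_y g x y * Num.min (a x) (a y) by [].
rewrite mulrDr addrACA; congr (_ + _).
  rewrite big_mkcond /= mulr_sumr -big_split /=; apply: eq_bigr => x _.
  by rewrite aE; case: (x \in U); rewrite ?mulr1n ?mulr0n; ring.
rewrite big_mkcond /= mulr_sumr -big_split /=; apply: eq_bigr => x _.
rewrite [X in _ * X](_ : _ = \sum_y g x y *+ ((x \in U) && (y \in U))); last first.
  case: (x \in U) => /=; last by rewrite big1.
  by rewrite big_mkcond /=; apply: eq_bigr => y _; case: (y \in U).
rewrite mulr_sumr -big_split /=; apply: eq_bigr => y _.
by rewrite minE; case: (_ && _); rewrite ?mulr1n ?mulr0n; ring.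
Qed.

Lemma enum_set_fun (R : realType) (T : finType) (U : {set T}) q : #|U| = q ->
  exists g : 'I_q -> T, (forall i, g i \in U) /\
    forall F : T -> R, \sum_i F (g i) = \sum_(x in U) F x.
Proof.
case: q /; exists enum_val; split=> [i|F]; first exact: enum_valP.
by rewrite -(big_enum_val F).
Qed.

Section SplitLevel.
Variables (R : realType) (T : finType) (c : T -> T -> R) (A : T -> T -> R).
Hypothesis (cP : centered_proj c).
Hypothesis A01 : forall x y, 0 <= A x y <= 1.
Let k : R := \sum_x c x x.

(** This is [split_trace_le] for the split graph in which [U] is completed to a clique and its
    complement emptied, with the shift by [#|U|] undone. Halving the ordered pairs in [U] counts
    each clique edge once. *)
Lemma split_level (U : {set T}) :
  \sum_(x in U) \sum_(y in U) sqdist c x y / 2 +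
  \sum_(x in U) \sum_(y in ~: U) A x y * (sqdist c x y - 1) <= \sum_(x in U) k.
Proof.
have [c_sym c_idem c1] := cP.
have sqU : \sum_(x in U) \sum_(y in U) sqdist c x y / 2 =
    #|U|%:R * \sum_(x in U) c x x - \sum_(x in U) \sum_(y in U) c x y.
  have -> : \sum_(x in U) \sum_(y in U) sqdist c x y / 2 =
      \sum_(x in U) \sum_(y in U) (c x x / 2) + \sum_(x in U) \sum_(y in U) (c y y / 2)
      - \sum_(x in U) \sum_(y in U) c x y.
    rewrite -big_split -sumrB /=; apply: eq_bigr => x _.
    by rewrite -big_split -sumrB /=; apply: eq_bigr => y _; rewrite /sqdist; field.
  congr (_ - _); rewrite [X in _ + X]exchange_big /= -mulr2n.
  under eq_bigr do rewrite sumr_const.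
  rewrite -[LHS]mulr_natr mulr_suml mulr_sumr; apply: eq_bigr => x _.
  by rewrite -[_ *+ #|U|]mulr_natr; field.
rewrite sqU sumr_const -[k *+ _]mulr_natl.
have kE : k = \sum_(x in U) c x x + \sum_(x in ~: U) c x x.
  rewrite /k (bigID (mem U)) /=; congr (_ + _).
  by apply: eq_bigl => x; rewrite inE.
(* [split_trace_le] needs both parts nonempty; when [U] or its complement is empty the two sides
   agree directly. *)
case EU: #|U| => [|N].
  by move/cards0_eq: EU => ->; rewrite !big_set0 !mul0r subrr addr0.
case EW: #|~: U| => [|N'].
  have UT : U = setT by rewrite -[U]setCK (cards0_eq EW) setC0.
  rewrite [X in _ + X](_ : _ = 0) ?addr0; last first.
    by rewrite UT setCT big1 // => x _; rewrite big_set0.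
  rewrite kE (cards0_eq EW) big_set0 addr0 [X in _ - X](_ : _ = 0) ?subr0 //.
  rewrite UT big1 // => x _; rewrite -[RHS](c1 x).
  by apply: eq_bigl => y; rewrite inE.
have [gU [gUin gUE]] := @enum_set_fun R _ _ _ EU.
have [gW [gWin gWE]] := @enum_set_fun R _ _ _ EW.
pose g i := match split i with inl u => gU u | inr w => gW w end.
have gl u : g (lshift N'.+1 u) = gU u.
  by rewrite /g; case: split_ordP => j /eqP; rewrite ?eq_lshift ?eq_lrshift // => /eqP ->.
have gr w : g (rshift N.+1 w) = gW w.
  by rewrite /g; case: split_ordP => j /eqP; rewrite ?eq_rshift ?eq_rlshift // => /eqP ->.
have gE (F : T -> R) : \sum_i F (g i) = \sum_x F x.
  rewrite big_split_ord /=; under eq_bigr do rewrite gl.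
  under [X in _ + X]eq_bigr do rewrite gr.
  rewrite gUE gWE [RHS](bigID (mem U)) /=; congr (_ + _).
  by apply: eq_bigl => x; rewrite inE.
pose B : 'M[R]_(N.+1, N'.+1) := \matrix_(u, w) A (gU u) (gW w).
pose P : 'M[R]_(N.+1 + N'.+1) := \matrix_(i, j) c (g i) (g j).
have B01 u w : 0 <= B u w <= 1 by rewrite mxE.
have := @split_trace_le R N N' B P B01.
have -> : P^T = P by apply/matrixP => i j; rewrite !mxE.
have -> : P *m P = P.
  apply/matrixP => i j; rewrite !mxE; under eq_bigr do rewrite !mxE.
  by rewrite (gE (fun z => c (g i) z * c z (g j))).
have -> : P *m const_mx 1 = 0 :> 'cV_(N.+1 + N'.+1).
  apply/matrixP => i j; rewrite !mxE; under eq_bigr do rewrite !mxE mulr1.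
  by rewrite (gE (c (g i))).
move=> /(_ erefl erefl erefl).
have trE : \tr (P *m split_mx B) =
    \sum_(x in U) \sum_(y in ~: U) A x y * (c x x + c y y - 2 * c x y)
    - \sum_(x in U) \sum_(y in U) c x y - N.+1%:R * \sum_(x in ~: U) c x x.
  rewrite /mxtrace big_split_ord /=.
  have rowU u : (P *m split_mx B) (lshift N'.+1 u) (lshift N'.+1 u) =
      \sum_(y in ~: U) (A (gU u) y * (c (gU u) (gU u) - c (gU u) y))
      - \sum_(y in U) c (gU u) y.
    rewrite mxE big_split_ord /=.
    under eq_bigr do rewrite block_mxEul !mxE !gl mulrBr mulr1 mulrnAr.
    under [X in _ + X]eq_bigr do rewrite block_mxEdl !mxE gl gr mulrN.
    rewrite sumrB gUE addrAC; congr (_ - _).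
    rewrite (bigD1 u) //= eqxx mulr1n [X in _ + X + _ = _]big1; last first.
      by move=> u' /negPf ->; rewrite mulr0n.
    rewrite addr0 mulr_sumr -big_split /= -gWE; apply: eq_bigr => w _.
    by rewrite mxE; ring.
  have rowW w : (P *m split_mx B) (rshift N.+1 w) (rshift N.+1 w) =
      \sum_(x in U) (A x (gW w) * (c (gW w) (gW w) - c x (gW w)))
      - N.+1%:R * c (gW w) (gW w).
    rewrite mxE big_split_ord /=.
    under eq_bigr do rewrite block_mxEur !mxE gl gr mulrN.
    under [X in _ + X]eq_bigr do rewrite block_mxEdr !mxE !gr mulrN mulrnAr.
    rewrite [X in _ + X](bigD1 w) //= eqxx mulr1n [X in _ + (_ + X)]big1; last first.
      by move=> w' /negPf ->; rewrite mulr0n oppr0.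
    rewrite addr0 sumrB sumr_const card_ord mulrBr opprB addrA.
    rewrite [_ * (1 *+ _)]mulrC; congr (_ - _).
    rewrite mulr_sumr -big_split /= -gUE; apply: eq_bigr => u _.
    by rewrite mxE (c_sym (gW w)); ring.
  under eq_bigr do rewrite rowU; under [X in _ + X]eq_bigr do rewrite rowW.
  rewrite !sumrB.
  rewrite (gUE (fun x => \sum_(y in ~: U) (A x y * (c x x - c x y)))).
  rewrite (gUE (fun x => \sum_(y in U) c x y)).
  rewrite (gWE (fun y => \sum_(x in U) (A x y * (c y y - c x y)))).
  rewrite (gWE (fun y => N.+1%:R * c y y)) -mulr_sumr.
  rewrite [X in _ + (X - _)]exchange_big /=.
  have -> : \sum_(x in U) \sum_(y in ~: U) A x y * (c x x + c y y - 2 * c x y) =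
    \sum_(x in U) \sum_(y in ~: U) A x y * (c x x - c x y) +
    \sum_(x in U) \sum_(y in ~: U) A x y * (c y y - c x y).
    rewrite -big_split /=; apply: eq_bigr => x _; rewrite -big_split /=.
    by apply: eq_bigr => y _; ring.
  by ring.
rewrite trE.
have -> : \sum_u \sum_w B u w = \sum_(x in U) \sum_(y in ~: U) A x y.
  rewrite -gUE; apply: eq_bigr => u _; rewrite -gWE.
  by apply: eq_bigr => w _; rewrite mxE.
have -> : \sum_(x in U) \sum_(y in ~: U) A x y * (sqdist c x y - 1) =
    \sum_(x in U) \sum_(y in ~: U) A x y * (c x x + c y y - 2 * c x y) -
    \sum_(x in U) \sum_(y in ~: U) A x y.
  rewrite -sumrB; apply: eq_bigr => x _; rewrite -sumrB; apply: eq_bigr => y _.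
  by rewrite /sqdist; ring.
rewrite kE; lra.
Qed.
End SplitLevel.

(** * The deviation inequality for projections *)

Section Brouwer.
Variables (R : realType) (T : finType) (adj : rel T) (c : T -> T -> R).
Hypotheses (adjC : symmetric adj) (cP : centered_proj c).
Let k : R := \sum_x c x x.
Let A x y : R := (adj x y)%:R.
Let mu x y : R := Num.min (c x x) (c y y).

(** The expressions whose squares measure the slack in Brouwer's inequality. At [x = y] the
    deviation is 0 when [adj] is irreflexive. *)
Definition deviation x y : R :=
  if adj x y then c x y + 1 - Num.max (c x x) (c y y)
  else c x y - Num.min (c x x) (c y y).

Lemma diag_ge0 x : 0 <= c x x.
Proof.
have [c_sym <- _] := cP; rewrite sumr_ge0 // => z _.
by rewrite (c_sym z) -expr2 sqr_ge0.
Qed.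

Lemma sqdistC x y : sqdist c x y = sqdist c y x.
Proof. by have [c_sym _ _] := cP; rewrite /sqdist (c_sym x y); ring. Qed.

(** In [split_level], the edges leaving [U] are all edges at [U] minus those inside [U]. This turns
    the bound into a sum over vertices of [U] plus a sum over pairs in [U], the shape that
    [level_average] integrates, here with [a x = c x x]. *)
Lemma averaged_split : 0 <= \sum_x (k + \sum_y A x y * (1 - sqdist c x y)) * c x x
   + \sum_x \sum_y (A x y * (sqdist c x y - 1) - sqdist c x y / 2) * mu x y.
Proof.
apply: level_average diag_ge0 => U.
have A01 x y : 0 <= A x y <= 1 by rewrite /A; case: adj; rewrite ?lexx ?ler01.
have := split_level cP A01 U.
have -> : \sum_(x in U) (k + \sum_y A x y * (1 - sqdist c x y)) =
    \sum_(x in U) k - \sum_(x in U) \sum_(y in ~: U) A x y * (sqdist c x y - 1)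
    - \sum_(x in U) \sum_(y in U) A x y * (sqdist c x y - 1).
  rewrite -!sumrB; apply: eq_bigr => x _.
  have -> : \sum_y A x y * (1 - sqdist c x y) = - \sum_y A x y * (sqdist c x y - 1).
    by rewrite -sumrN; apply: eq_bigr => y _; ring.
  rewrite [\sum_y _](bigID (mem U)) /=.
  have -> : \sum_(y | y \notin U) A x y * (sqdist c x y - 1) =
      \sum_(y in ~: U) A x y * (sqdist c x y - 1).
    by apply: eq_bigl => y; rewrite inE.
  by ring.
have -> : \sum_(x in U) \sum_(y in U) (A x y * (sqdist c x y - 1) - sqdist c x y / 2) =
    \sum_(x in U) \sum_(y in U) A x y * (sqdist c x y - 1)
    - \sum_(x in U) \sum_(y in U) sqdist c x y / 2.
  by rewrite -sumrB; apply: eq_bigr => x _; rewrite -sumrB.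
lra.
Qed.

(* With [M] and [m] the maximum and minimum of the two diagonal entries and
   [t] the squared distance, [(c + 1 - M) ^+ 2 - (c - m) ^+ 2] factors as
   [(1 - M + m) * (1 - t)]; moreover [m * M] is the product of the entries. *)
Lemma sum_deviation :
  \sum_x \sum_y deviation x y ^+ 2 +
  2 * (\sum_x (k + \sum_y A x y * (1 - sqdist c x y)) * c x x
   + \sum_x \sum_y (A x y * (sqdist c x y - 1) - sqdist c x y / 2) * mu x y) =
  k ^+ 2 + k - \sum_x \sum_y A x y * (sqdist c x y - 1).
Proof.
have [c_sym c_idem _] := cP.
have devE x y : deviation x y ^+ 2 + 2 * ((A x y * (sqdist c x y - 1)
    - sqdist c x y / 2) * mu x y) + A x y * (1 - sqdist c x y) * (c x x + c y y) =
    c x y ^+ 2 - c x x * c y y + A x y * (1 - sqdist c x y).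
  rewrite /deviation /mu /A /sqdist.
  by case: (leP (c x x) (c y y)) => _; case: (adj x y) => /=; field.
have sumC : 2 * (\sum_x (\sum_y A x y * (1 - sqdist c x y)) * c x x) =
    \sum_x \sum_y A x y * (1 - sqdist c x y) * (c x x + c y y).
  have E : \sum_x (\sum_y A x y * (1 - sqdist c x y)) * c x x =
      \sum_x \sum_y A x y * (1 - sqdist c x y) * c x x.
    by apply: eq_bigr => x _; rewrite mulr_suml.
  rewrite mulr_natl mulr2n {2}E exchange_big /= E -big_split /=.
  apply: eq_bigr => x _; rewrite -big_split /=; apply: eq_bigr => y _.
  by rewrite /A (adjC y x) (sqdistC y x); ring.
have kk : \sum_x k * c x x = k ^+ 2 by rewrite -mulr_sumr.
(* Both sides are the trace of the projection, by idempotence. *)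
have cc : \sum_x \sum_y c x y ^+ 2 = k.
  apply: eq_bigr => x _; rewrite -[RHS]c_idem; apply: eq_bigr => y _.
  by rewrite expr2 [in RHS](c_sym y).
have aa : \sum_x \sum_y c x x * c y y = k ^+ 2.
  by rewrite expr2 {1}/k mulr_suml; apply: eq_bigr => i _; rewrite mulr_sumr.
have -> : \sum_x (k + \sum_y A x y * (1 - sqdist c x y)) * c x x =
    k ^+ 2 + \sum_x (\sum_y A x y * (1 - sqdist c x y)) * c x x.
  by rewrite -kk -big_split /=; apply: eq_bigr => x _; rewrite mulrDl.
rewrite !mulrDr sumC.
have -> : 2 * (\sum_x \sum_y (A x y * (sqdist c x y - 1) - sqdist c x y / 2) * mu x y)
    = \sum_x \sum_y 2 * ((A x y * (sqdist c x y - 1) - sqdist c x y / 2) * mu x y).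
  by rewrite mulr_sumr; apply: eq_bigr => x _; rewrite mulr_sumr.
set D2 := \sum_x \sum_y deviation x y ^+ 2.
set S1 := \sum_x \sum_y A x y * (1 - sqdist c x y) * (c x x + c y y).
set S2 := \sum_x \sum_y 2 * _.
have : D2 + S2 + S1 = k - k ^+ 2 + \sum_x \sum_y A x y * (1 - sqdist c x y).
  rewrite -aa -cc -sumrB -!big_split /=; apply: eq_bigr => x _.
  by rewrite -sumrB -!big_split /=; apply: eq_bigr => y _.
have -> : \sum_x \sum_y A x y * (1 - sqdist c x y) =
    - \sum_x \sum_y A x y * (sqdist c x y - 1).
  by rewrite -sumrN; apply: eq_bigr => x _; rewrite -sumrN; apply: eq_bigr => y _; ring.
lra.
Qed.

Lemma sum_deviation_le :
  \sum_x \sum_y deviation x y ^+ 2 <=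
  k ^+ 2 + k - \sum_x \sum_y A x y * (sqdist c x y - 1).
Proof. by have := averaged_split; rewrite -sum_deviation; lra. Qed.
End Brouwer.

(** * Peeling off isolated and dominating vertices *)

(** A threshold construction that also counts its dominating steps. The initial vertex counts 0, so
    the final count is the clique number minus 1. *)
Inductive dominating_count (T : finType) (adj : rel T) : seq T -> nat -> Prop :=
| dominating_count_single x : dominating_count adj [:: x] 0
| dominating_count_isolated x l k : dominating_count adj l k -> x \notin l ->
    {in l, forall y, ~~ adj x y} -> dominating_count adj (x :: l) k
| dominating_count_dominating x l k : dominating_count adj l k -> x \notin l ->
    {in l, forall y, adj x y} -> dominating_count adj (x :: l) k.+1.

Section Peel.
Variables (R : realType) (T : finType) (adj : rel T).

(** Induction on [D]. Vanishing deviations force a vertex of [D] to be isolated or dominating. An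
    isolated one has a zero row and is simply dropped; a dominating one is removed together with a
    rank-one projection, which lowers the trace by 1. *)
Lemma tight_dominating_count (D : {set T}) (c : T -> T -> R) (k : nat) :
  D != set0 ->
  {in D &, forall x y, c x y = c y x} ->
  {in D &, forall x y, \sum_(z in D) c x z * c z y = c x y} ->
  {in D, forall x, \sum_(y in D) c x y = 0} ->
  \sum_(x in D) c x x = k%:R ->
  {in D &, forall x y, x != y -> adj x y -> c x y = Num.max (c x x) (c y y) - 1} ->
  {in D &, forall x y, x != y -> ~~ adj x y -> c x y = Num.min (c x x) (c y y)} ->
  exists2 l, dominating_count adj l k & l =i D.
Proof.
have [m] := ubnP #|D|; elim: m D c k => // m IHm D c k lt_m D0 c_sym c_idem c1 ck cE cN.
have sqE x : x \in D -> \sum_(z in D) c x z ^+ 2 = c x x.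
  move=> xD; rewrite -[RHS](c_idem x x xD xD); apply: eq_bigr => z zD.
  by rewrite expr2 [in X in _ = _ * X]c_sym.
have a_ge0 x : x \in D -> 0 <= c x x.
  by move=> xD; rewrite -(sqE x xD) sumr_ge0 // => z _; exact: sqr_ge0.
(* The off-diagonal squares of row [x] sum to [c x x - c x x ^+ 2]. If [c x x >= 1] they all vanish,
   and then the zero row sum contradicts [c x x >= 1]. *)
have a_lt1 x : x \in D -> c x x < 1.
  move=> xD; have := sqE x xD; rewrite (bigD1 x) //=.
  have := c1 x xD; rewrite (bigD1 x) //=.
  set s := \sum_(_ in _ | _) _; set q := \sum_(_ in _ | _) _ => s1 q1.
  have q0 : 0 <= q by rewrite sumr_ge0 // => z _; exact: sqr_ge0.
  have ax := a_ge0 x xD.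
  rewrite ltNge; apply/negP => a1.
  have q_eq0 : q = 0 by nra.
  have s_eq0 : s = 0.
    rewrite /s big1 // => z zD; apply/eqP; rewrite -sqrf_eq0; apply/eqP.
    have sq0 w : (w \in D) && (w != x) -> 0 <= c x w ^+ 2 by rewrite sqr_ge0.
    exact: psumr_eq0P sq0 q_eq0 z zD.
  lra.
have [v0 v0D] := set0Pn _ D0.
case: (@arg_maxP _ R _ v0 (mem D) (fun x => c x x) v0D) => v vD' vmax.
have vD : v \in D by [].
have a_le x : x \in D -> c x x <= c v v by move=> xD; apply: vmax.
have vN x : x \in D -> x != v -> ~~ adj v x -> c x x = 0.
  move=> xD xv vx.
  (* [h z = c v z * (c v z - (c v v - 1))] is zero on neighbours of [v] and nonnegative on
     non-neighbours. Its total over [D] is [c v v], already reached at [z = v], so it vanishes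
     elsewhere; this forces [c x x = 0] at each non-neighbour. *)
  pose h z := c v z ^+ 2 - (c v v - 1) * c v z.
  have h_ge0 z : z \in D -> z != v -> 0 <= h z.
    move=> zD zv; rewrite /h; case: (boolP (adj v z)) => vz.
      by rewrite cE // 1?eq_sym // max_l ?a_le // expr2 subrr.
    rewrite cN // 1?eq_sym // min_r ?a_le //.
    have := a_ge0 z zD; have := a_lt1 v vD; nra.
  have hsum : \sum_(z in D | z != v) h z = 0.
    have : \sum_(z in D) h z = c v v.
      by rewrite sumrB sqE // -mulr_sumr c1 // mulr0 subr0.
    by rewrite (bigD1 v) //= {1}/h => e; lra.
  have := psumr_eq0P (fun z zD => h_ge0 z (andP zD).1 (andP zD).2) hsum (i := x).
  rewrite xD xv => /(_ isT); rewrite /h cN // 1?eq_sym // min_r ?a_le //.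
  have := a_ge0 x xD; have := a_lt1 v vD; nra.
(* A non-neighbour [j] of [v] has a zero row, and an edge from [j] to [z] would require
   [c j z = c z z - 1 < 0]; so [j] is isolated in [D]. If there is no such [j], [v] is
   dominating. *)
have [/existsP[j /and3P[jD jv vj]]|/existsPn noj] :=
    boolP [exists j, [&& j \in D, j != v & ~~ adj v j]].
- have aj : c j j = 0 by exact: vN.
  have cj z : z \in D -> c j z = 0.
    move=> zD; apply/eqP; rewrite -sqrf_eq0; apply/eqP.
    have sq0 w : w \in D -> 0 <= c j w ^+ 2 by rewrite sqr_ge0.
    by apply: (psumr_eq0P sq0) => //; rewrite sqE.
  have jN z : z \in D -> z != j -> ~~ adj j z.
    move=> zD zj; apply/negP => jz; have := cE j z jD zD.
    rewrite eq_sym zj => /(_ isT jz); rewrite cj // aj max_r ?a_ge0 //.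
    by have := a_lt1 z zD; lra.
  have sumDj (F : T -> R) : F j = 0 -> \sum_(z in D :\ j) F z = \sum_(z in D) F z.
    by move=> Fj; rewrite [RHS](big_setD1 j) //= Fj add0r.
  have [||||||||l ld lD] := IHm (D :\ j) c k.
  + by move: lt_m; rewrite (cardsD1 j D) jD add1n ltnS.
  + by apply/set0Pn; exists v; rewrite !inE eq_sym jv.
  + by move=> x y /setD1P[_ xD] /setD1P[_ yD]; exact: c_sym.
  + move=> x y /setD1P[_ xD] /setD1P[_ yD]; rewrite sumDj ?c_idem //.
    by rewrite cj // mulr0.
  + move=> x /setD1P[_ xD]; rewrite sumDj ?c1 //.
    by rewrite c_sym // cj.
  + by rewrite sumDj.
  + by move=> x y /setD1P[_ xD] /setD1P[_ yD]; exact: cE.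
  + by move=> x y /setD1P[_ xD] /setD1P[_ yD]; exact: cN.
  exists (j :: l).
    apply: dominating_count_isolated => //; first by rewrite lD !inE eqxx.
    by move=> z; rewrite lD => /setD1P[zj zD]; exact: jN.
  by move=> z; rewrite inE lD !inE; case: eqVneq => [->|].
have vE x : x \in D -> x != v -> adj v x.
  by move=> xD xv; have := noj x; rewrite xD xv /= negbK.
pose n := #|D :\ v|; have Dn : #|D| = n.+1 by rewrite (cardsD1 v) vD.
set b : R := 1 - c v v.
have cv x : x \in D -> x != v -> c v x = - b.
  by move=> xD xv; rewrite cE ?vE // 1?eq_sym // max_l ?a_le // /b; ring.
have sumDv (F : T -> R) : \sum_(z in D) F z = F v + \sum_(z in D :\ v) F z.
  by rewrite (big_setD1 v).
have bn : c v v = n%:R * b.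
  have := c1 v vD; rewrite sumDv (eq_bigr (fun=> - b)); last first.
    by move=> z /setD1P[zv zD]; rewrite cv.
  by rewrite sumr_const -/n -[_ *+ n]mulr_natl; lra.
have [Dv0|[w wD]] := set_0Vmem (D :\ v).
  have n0 : n = 0%N by rewrite /n Dv0 cards0.
  have cvv : c v v = 0 by rewrite bn n0 mul0r.
  have k0 : k = 0%N.
    apply/eqP; rewrite -(eqr_nat R) -ck sumDv Dv0 big_set0 cvv addr0 //.
  exists [:: v]; first by rewrite k0; constructor.
  move=> z; rewrite inE; case: eqVneq => [->//|zv].
  by have := in_set0 z; rewrite -Dv0 !inE zv.
have n_gt0 : (0 < n)%N by apply/card_gt0P; exists w.
have n1 : (n%:R : R) + 1 != 0 by rewrite natr1 pnatr_eq0.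
have n0 : (n%:R : R) != 0 by rewrite pnatr_eq0 -lt0n.
have bE : b = (n%:R + 1)^-1.
  by apply: (mulfI n1); rewrite mulfV // mulrDl mul1r -bn /b; ring.
(* The projection onto the vector with entry [n] at [v] and -1 on the rest of [D] has row [v] equal
   to that of [c], and is the constant [e] away from [v]. Subtracting a constant keeps the relations
   with the maximum and minimum. *)
pose e : R := (n%:R * (n%:R + 1))^-1.
pose c' x y := c x y - e.
have cvv_gt0 : 0 < c v v.
  by rewrite bn bE mulr_gt0 ?invr_gt0 ?ltr0n // ltr_wpDl // ler0n.
have [k' kE] : exists k', k = k'.+1.
  case: k ck => [|k'] ck; last by exists k'.
  move: ck; rewrite sumDv => ck.
  have : 0 <= \sum_(z in D :\ v) c z z.
    by rewrite sumr_ge0 // => z /setD1P[_ zD]; exact: a_ge0.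
  by lra.
have tr' : \sum_(x in D :\ v) c' x x = k'%:R.
  rewrite sumrB sumr_const -/n -[_ *+ n]mulr_natl.
  move: ck; rewrite sumDv kE -natr1 => ck.
  rewrite (_ : \sum_(z in D :\ v) c z z = k'%:R + 1 - c v v); last by lra.
  by rewrite bn bE /e; field; rewrite n0 n1.
have [||||||||l ld lD] := IHm (D :\ v) c' k'.
+ by move: lt_m; rewrite (cardsD1 v D) vD add1n ltnS.
+ by apply/set0Pn; exists w.
+ by move=> x y /setD1P[_ xD] /setD1P[_ yD]; rewrite /c' c_sym.
+ move=> x y /setD1P[xv xD] /setD1P[yv yD].
  have := c_idem x y xD yD; rewrite sumDv c_sym // !cv // => idem.
  have := c1 x xD; rewrite sumDv c_sym // cv // => cx1.
  have := c1 y yD; rewrite sumDv c_sym // cv // => cy1.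
  have -> : \sum_(z in D :\ v) c' x z * c' z y =
      \sum_(z in D :\ v) c x z * c z y - e * \sum_(z in D :\ v) c x z
      - e * \sum_(z in D :\ v) c y z + n%:R * e ^+ 2.
    rewrite !mulr_sumr -!sumrB mulr_natl -sumr_const -big_split /=.
    apply: eq_bigr => z /setD1P[_ zD]; rewrite /c' (c_sym y z) //; ring.
  rewrite (_ : \sum_(z in D :\ v) c x z = b); last by lra.
  rewrite (_ : \sum_(z in D :\ v) c y z = b); last by lra.
  rewrite (_ : \sum_(z in D :\ v) c x z * c z y = c x y - b ^+ 2); last by lra.
  by rewrite /c' bE /e; field; rewrite n0 n1.
+ move=> x /setD1P[xv xD]; have := c1 x xD; rewrite sumDv c_sym // cv // => cx1.
  rewrite sumrB sumr_const -/n -[_ *+ n]mulr_natl.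
  rewrite (_ : \sum_(z in D :\ v) c x z = b); last by lra.
  by rewrite bE /e; field; rewrite n0 n1.
+ exact: tr'.
+ move=> x y /setD1P[_ xD] /setD1P[_ yD] xy xyA; rewrite /c' cE // -addr_maxl.
  by ring.
+ move=> x y /setD1P[_ xD] /setD1P[_ yD] xy xyA; by rewrite /c' cN // -addr_minl.
exists (v :: l).
  rewrite kE; apply: dominating_count_dominating => //; first by rewrite lD !inE eqxx.
  by move=> z; rewrite lD => /setD1P[zj zD]; exact: vE.
by move=> z; rewrite inE lD !inE; case: eqVneq => [->|].
Qed.
End Peel.

Lemma sum_in_cons (R : realType) (T : finType) (x : T) (l : seq T) (F : T -> R) :
  x \notin l -> \sum_(z in x :: l) F z = F x + \sum_(z in l) F z.
Proof.
move=> xl; rewrite (bigD1 x) ?inE ?eqxx //=; congr (_ + _).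
apply: eq_bigl => z; rewrite inE; case: eqVneq => [->|_] /=; last by rewrite andbT.
by rewrite (negPf xl).
Qed.

(** Reverse of the peeling: each dominating vertex [x] adds the projection onto the vector [g],
    equal to [n] at [x] and -1 on the earlier vertices. The edge sum over ordered pairs then grows
    by [2 * (k + 1)]. *)
Lemma dominating_count_proj (R : realType) (T : finType) (adj : rel T) l k :
  symmetric adj -> irreflexive adj -> dominating_count adj l k ->
  exists c : T -> T -> R,
    [/\ centered_proj c, forall x y, x \notin l -> c x y = 0,
        \sum_x c x x = k%:R &
        \sum_(x in l) \sum_(y in l) (adj x y)%:R * (sqdist c x y - 1) =
          k%:R ^+ 2 + k%:R].
Proof.
move=> adjC adj_irr; elim=> {l k} [x|x l k _ [c [cP cl ck cE]] xl xN|
  x l k ld [c [cP cl ck cE]] xl xD].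
- exists (fun _ _ => 0); split=> //.
  + by split=> // *; rewrite big1 // => *; rewrite mul0r.
  + by rewrite big1.
  rewrite sum_in_cons // sum_in_cons // adj_irr mul0r !big_pred0 => //.
  by rewrite !addr0 expr0n.
- exists c; split=> // [y z|].
    by rewrite inE negb_or => /andP[_]; exact: cl.
  rewrite sum_in_cons // sum_in_cons // adj_irr mul0r add0r big1 ?add0r.
    rewrite -cE; apply: eq_bigr => y yl.
    by rewrite sum_in_cons // adjC (negPf (xN y yl)) mul0r add0r.
  by move=> y yl; rewrite (negPf (xN y yl)) mul0r.
have [c_sym c_idem c1] := cP.
pose n := #|[set y in l]|.
have n_gt0 : (0 < n)%N.
  apply/card_gt0P; case: ld => [y|y l' k' _ _ _|y l' k' _ _ _]; exists y;
  by rewrite !inE eqxx.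
have n0 : (n%:R : R) != 0 by rewrite pnatr_eq0 -lt0n.
have n1 : (n%:R : R) + 1 != 0 by rewrite natr1 pnatr_eq0.
have sum1 (a : R) : \sum_(y in l) a = n%:R * a.
  rewrite sumr_const mulr_natl; congr (_ *+ _).
  by apply: eq_card => y; rewrite inE.
pose g z : R := if z == x then n%:R else - (z \in l)%:R.
pose e : R := (n%:R * (n%:R + 1))^-1.
have gx : g x = n%:R by rewrite /g eqxx.
have gl z : z \in l -> g z = -1.
  by move=> zl; rewrite /g zl; case: eqVneq => // zx; rewrite -zx zl in xl.
have g0 z : z != x -> z \notin l -> g z = 0.
  by move=> /negPf zx /negPf zl; rewrite /g zx zl oppr0.
have cr y z : z \notin l -> c y z = 0 by move=> zl; rewrite c_sym cl.
have sumg (F : T -> R) : (forall z, g z = 0 -> F z = 0) ->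
    \sum_z F z = F x + \sum_(z in l) F z.
  move=> Fg; rewrite -(sum_in_cons _ xl) [RHS]big_mkcond /=; apply: eq_bigr => z _.
  by rewrite inE; case: eqVneq => //= zx; case: ifPn => // zl; rewrite Fg ?g0.
have sg1 : \sum_z g z = 0.
  rewrite sumg // gx (eq_bigr (fun=> -1)) ?sum1 => [|z]; last exact: gl.
  by ring.
have sg2 : \sum_z g z ^+ 2 = n%:R ^+ 2 + n%:R.
  rewrite sumg => [|z ->]; last by rewrite expr0n.
  rewrite gx (eq_bigr (fun=> 1)) ?sum1 ?mulr1 // => z zl.
  by rewrite gl // sqrrN expr1n.
have cg y : \sum_z c y z * g z = 0.
  rewrite (eq_bigr (fun z => - c y z)) ?sumrN ?c1 ?oppr0 // => z _.
  case: (boolP (z \in l)) => zl; first by rewrite gl // mulrN1.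
  by rewrite cr // mul0r oppr0.
have eV : e * (n%:R ^+ 2 + n%:R) = 1.
  by rewrite /e; field; rewrite n0 n1.
pose c' y z := c y z + e * g y * g z.
(* Inside [l] the added term is constant, so distances do not change; only the pairs containing [x]
   contribute something new. *)
have sqdist_l y z : y \in l -> z \in l -> sqdist c' y z = sqdist c y z.
  by move=> yl zl; rewrite /sqdist /c' !gl //; ring.
have sqdist_x y : y \in l -> sqdist c' x y = c y y + 1 + n%:R^-1.
  move=> yl; rewrite /sqdist /c' gx gl // !(cl x) // /e; by field; rewrite n0 n1.
have c'P : centered_proj c'.
  split=> [y z|y z|y].
  - by rewrite /c' (c_sym y); ring.
  - have -> : \sum_w c' y w * c' w z = \sum_w c y w * c w z
        + e * g z * (\sum_w c y w * g w) + e * g y * (\sum_w c z w * g w)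
        + e * g y * g z * (e * \sum_w g w ^+ 2).
      rewrite !mulr_sumr -!big_split /=; apply: eq_bigr => w _.
      by rewrite /c' (c_sym z w); ring.
    by rewrite !cg c_idem sg2 eV /c'; ring.
  rewrite big_split /= c1 add0r; under eq_bigr do rewrite -mulrA.
  by rewrite -!mulr_sumr sg1 !mulr0.
have sum_cl : \sum_(y in l) c y y = k%:R.
  rewrite -ck [LHS]big_mkcond /=; apply: eq_bigr => y _.
  by case: ifPn => // yl; rewrite cl.
exists c'; split=> // [y z||].
- rewrite inE negb_or => /andP[yx yl].
  by rewrite /c' cl // g0 // mulr0 mul0r addr0.
- rewrite big_split /= ck; under [X in _ + X]eq_bigr do rewrite -mulrA -expr2.
  by rewrite -mulr_sumr sg2 eV natr1.
have sum_x : \sum_(y in l) (c y y + 1 + n%:R^-1 - 1) = k%:R + 1.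
  rewrite -sum_cl -[X in _ + X](mulfV n0) -(sum1) -big_split /=.
  by apply: eq_bigr => y _; ring.
rewrite sum_in_cons // sum_in_cons // adj_irr mul0r add0r.
rewrite (eq_bigr (fun y => c y y + 1 + n%:R^-1 - 1)) => [|y yl]; last first.
  by rewrite sqdist_x // xD // mul1r.
rewrite sum_x.
have -> : \sum_(y in l) \sum_(z in x :: l) (adj y z)%:R * (sqdist c' y z - 1) =
    \sum_(y in l) (c y y + 1 + n%:R^-1 - 1) +
    \sum_(y in l) \sum_(z in l) (adj y z)%:R * (sqdist c y z - 1).
  rewrite -big_split /=; apply: eq_bigr => y yl.
  rewrite sum_in_cons // adjC xD // mul1r (sqdistC c'P) sqdist_x //.
  by congr (_ + _); apply: eq_bigr => z zl; rewrite sqdist_l.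
by rewrite sum_x cE -natr1; ring.
Qed.

(** * Sums of largest eigenvalues *)

(** After subtracting the [k]-th value [d], the first [k] terms are nonnegative and the others
    nonpositive, so weight 1 on the former and 0 on the latter is optimal. *)
Lemma weighted_sum_le_top (R : realType) n k (s w : 'I_n -> R) :
  (0 < k <= n)%N -> (forall i j : 'I_n, (i <= j)%N -> s j <= s i) ->
  (forall i, 0 <= w i <= 1) -> \sum_i w i = k%:R ->
  \sum_i s i * w i <= \sum_(i < n | (i < k)%N) s i.
Proof.
move=> /andP[k_gt0 k_le] s_mono w01 sw.
have [k' kE] : exists k', k = k'.+1 by exists k.-1; rewrite prednK.
have k'n : (k' < n)%N by rewrite -kE.
pose d := s (Ordinal k'n).
have : \sum_i (s i - d) * w i <= \sum_(i < n | (i < k)%N) (s i - d).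
  rewrite [leRHS]big_mkcond /=; apply: ler_sum => i _.
  have /andP[w0 w1] := w01 i; case: ltnP => ik.
    by rewrite ler_piMr // subr_ge0; apply: s_mono; rewrite /= -ltnS -kE.
  rewrite mulr_le0_ge0 // subr_le0; apply: s_mono => /=; rewrite -ltnS -kE.
  exact: leqW.
rewrite sumrB; under eq_bigr do rewrite mulrBl.
rewrite sumrB -mulr_sumr sw sumr_const.
have -> : #|[pred i : 'I_n | (i < k)%N]| = k.
  rewrite -sum1_card (eq_bigl (fun i : 'I_n => (i < k)%N)) //.
  by rewrite -(big_ord_widen n (fun=> 1%N) k_le) sum1_card card_ord.
by rewrite mulr_natr lerD2r.
Qed.

(** Ky Fan's variational principle restricted to projections that kill the constants. The
    restriction costs nothing: the constants carry eigenvalue 0, the least one of a positive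
    semidefinite matrix, and [k < m]. *)
Lemma top_eigenvalue_sum (R : realType) m (L : 'M[R]_m) k :
  L^T = L -> (const_mx 1 : 'rV_m) *m L = 0 ->
  (forall v : 'rV_m, 0 <= (v *m L *m v^T) 0 0) -> (0 < k < m)%N ->
  (exists P : 'M[R]_m, [/\ P^T = P, P *m P = P, P *m const_mx 1 = 0 :> 'cV_m,
      \tr P = k%:R & \tr (P *m L) = \sum_(i < k) (eigenvalues L)`_i]) /\
  (forall P : 'M[R]_m, P^T = P -> P *m P = P -> P *m const_mx 1 = 0 :> 'cV_m ->
     \tr P = k%:R -> \tr (P *m L) <= \sum_(i < k) (eigenvalues L)`_i).
Proof.
case: m L => [|n] L symL oneL psdL /andP[k_gt0 k_lt]; first by [].
have oneL' : (const_mx 1 : 'rV_n.+1) *m L = 0 *: const_mx 1 by rewrite scale0r.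
have [F [d [FF F1 FtF FL]]] := centered_eigenbasis symL oneL'.
have k_le : (k <= n)%N by [].
have d_ge0 i : 0 <= d 0 i.
  have := psdL (row i F); rewrite -row_mul FL.
  have -> : row i (diag_mx d *m F) = d 0 i *: row i F.
    by apply/rowP => j; rewrite mul_diag_mx !mxE.
  rewrite -scalemxAl.
  have -> : row i F *m (row i F)^T = 1%:M.
    apply/matrixP => u v; rewrite !ord1 [RHS]mxE eqxx.
    have := congr1 (fun M : 'M_n => M i i) FF; rewrite [RHS]mxE eqxx => <-.
    by rewrite !mxE; apply: eq_bigr => j _; rewrite !mxE.
  by rewrite !mxE mulr1n mulr1.
pose t : n.-tuple R := [tuple d 0 i | i < n].
pose ds := sort >=%R t.
have size_ds : size ds = n by rewrite size_sort size_tuple.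
have ge_trans : transitive (>=%R : rel R) by move=> y x z xy yz; exact: le_trans yz xy.
have ge_anti : antisymmetric (>=%R : rel R).
  by move=> x y; rewrite andbC; exact: le_anti.
have ds_sorted : sorted >=%R ds by apply: sort_sorted => x y; exact: le_total.
(* The zero eigenvalue of the constants goes last, so the first [k <= n] entries come from the
   centered eigenbasis. *)
have evE : eigenvalues L = rcons ds 0.
  apply: (sorted_eq ge_trans ge_anti).
  - exact: eigenvalues_sorted.
  - rewrite sorted_pairwise // pairwise_rcons -sorted_pairwise // ds_sorted andbT.
    apply/allP => x; rewrite mem_sort => /mapP[i _ ->]; exact: d_ge0.
  apply: perm_trans (eigenvalues_perm (s := 0 :: t) _) _.
    rewrite (char_poly_centered symL oneL' FF F1 FL) big_cons big_map.
    by rewrite big_enum.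
  by rewrite perm_sym perm_rcons perm_cons perm_sort.
have [p pE] : exists p : 'S_n, ds = [tuple tnth t (p i) | i < n].
  by apply/tuple_permP; rewrite perm_sort.
have dsE (i : 'I_n) : ds`_i = d 0 (p i).
  by rewrite pE -tnth_nth !tnth_mktuple.
have evk : \sum_(i < k) (eigenvalues L)`_i = \sum_(i < n | (i < k)%N) d 0 (p i).
  rewrite evE (big_ord_widen n (fun i => (rcons ds 0)`_i) k_le).
  by apply: eq_bigr => i _; rewrite nth_rcons size_ds ltn_ord dsE.
rewrite evk; split.
  pose h (i : 'I_k) := p (widen_ord k_le i).
  have h_inj : injective h.
    by move=> i j /perm_inj /(congr1 val) /= ij; apply: val_inj.
  pose G := rowsub h F.
  have GG : G *m G^T = 1%:M by exact: rowsub_orth.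
  have GL : G *m L = diag_mx (\row_i d 0 (h i)) *m G by exact: rowsub_eigen.
  exists (G^T *m G); split.
  - by rewrite trmx_mul trmxK.
  - by rewrite -mulmxA (mulmxA G) GG mul1mx.
  - rewrite -mulmxA [X in _ *m X](_ : _ = 0) ?mulmx0 //.
    apply/matrixP => i j; have := congr1 (fun M : 'cV_n => M (h i) 0) F1.
    rewrite !mxE => e; rewrite -[RHS]e; apply: eq_bigr => l _.
    by rewrite [const_mx 1 _ _]mxE [const_mx 1 _ _ in RHS]mxE /G mxE.
  - by rewrite mxtrace_mulC GG mxtrace1.
  rewrite -mulmxA GL mxtrace_mulC -mulmxA GG mulmx1 mxtrace_diag.
  rewrite (big_ord_narrow k_le) /=.
  by apply: eq_bigr => i _; rewrite mxE.
move=> P symP PP P1 trP; rewrite (trace_eigenbasis FL FtF P1).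
rewrite (reindex_inj (@perm_inj _ p)) /=.
apply: (@weighted_sum_le_top _ n k (fun i => d 0 (p i))
  (fun i => (F *m P *m F^T) (p i) (p i))).
- by rewrite k_gt0.
- move=> i j ij; rewrite -!dsE.
  have ge_refl : reflexive (>=%R : rel R) by move=> x; exact: lexx.
  by apply: (sorted_leq_nth ge_trans ge_refl 0 ds_sorted); rewrite ?inE ?size_ds.
- by move=> i; rewrite eigenbasis_weight_ge0 // eigenbasis_weight_le1.
by rewrite -trP -(eigenbasis_weight_sum FtF symP P1) [RHS](reindex_inj (@perm_inj _ p)).
Qed.

Lemma sum_eigenvalues (R : realType) m (L : 'M[R]_m) :
  L^T = L -> \sum_(i < m) (eigenvalues L)`_i = \tr L.
Proof.
case: m L => [|n] L symL; first by rewrite big_ord0 /mxtrace big_ord0.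
have sz := size_eigenvalues symL.
have := @coefPn_prod_XsubC R (eigenvalues L); rewrite sz => /(_ isT).
rewrite -(char_poly_eigenvalues symL) char_poly_trace // => /oppr_inj ->.
by rewrite [RHS](big_nth 0) sz big_mkord.
Qed.

(** * Threshold graphs *)

Local Close Scope ring_scope.

Section Combinatorics.
Variables (T : finType) (adj : rel T).
Hypotheses (adjC : symmetric adj) (adj_irr : irreflexive adj).

Lemma threshold_seq_dominating_count l :
  threshold_seq adj l -> exists k, dominating_count adj l k.
Proof.
elim=> {l} [x|x l _ [k lk] xl xN|x l _ [k lk] xl xD].
- by exists 0; exact: dominating_count_single.
- by exists k; exact: dominating_count_isolated.
- by exists k.+1; exact: dominating_count_dominating.
Qed.

(** The family relative to the subgraph induced on [l]: neighbourhoods are cut down to [l], and [S]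
    is given only through its listing [v]. *)
Definition family_on (l : seq T) (k : nat) (U Rs : {set T}) (v : seq T) : Prop :=
  let nb x := nbr adj x :&: [set z in l] in
  [/\ forall z, (z \in l) = [|| z \in U, z \in Rs | z \in v],
      [/\ [disjoint U & Rs], {in U, forall z, z \notin v} & {in Rs, forall z, z \notin v}],
      [/\ clique adj U, independent adj Rs & {in Rs & U, forall x y, adj x y}],
      #|U| = k /\ Rs != set0
    & [/\ uniq v, {in v, forall x, nb x \proper U}
        & sorted (fun x y => nb y \subset nb x) v]].

(** A new dominating vertex joins the clique [U], enlarging all neighbourhoods alike; a new isolated
    vertex has an empty neighbourhood and goes to the end of [v]. *)
Lemma dominating_count_family_on l k : dominating_count adj l k ->
  exists U Rs v, family_on l k U Rs v.
Proof.
elim=> {l k} [x|x l k _ [U [Rs [v H]]] xl xN|x l k _ [U [Rs [v H]]] xl xD].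
- exists set0, [set x], [::]; split=> //; first by move=> z; rewrite !inE orbF.
  + by split; [rewrite -setI_eq0 set0I|move=> z; rewrite inE|].
  + split; [|by apply/forall_inP => a /set1P->; apply/forall_inP => b /set1P->; rewrite adj_irr|].
      by apply/forall_inP => a; rewrite inE.
    by move=> a b _; rewrite inE.
  + by rewrite cards0; split=> //; apply/set0Pn; exists x; rewrite inE.
- have [lE [URs Uv Rsv] [Ucl Rsi RsU] [Uk Rs0] [v_uniq vU v_sorted]] := H.
  have nbE y : y \in l ->
      nbr adj y :&: [set z in x :: l] = nbr adj y :&: [set z in l].
    move=> yl; apply/setP => z; rewrite !inE; case: eqVneq => [->|//] /=.
    by rewrite adjC (negPf (xN y yl)).
  have vl y : y \in v -> y \in l by move=> yv; rewrite lE yv !orbT.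
  have v_sorted' : sorted (fun y z => nbr adj z :&: [set t in x :: l]
      \subset nbr adj y :&: [set t in x :: l]) v.
    apply: (sub_in_sorted (P := mem v)) v_sorted; last by apply/allP.
    by move=> y z yv zv /=; rewrite !nbE ?vl.
  (* While [U] is empty no neighbourhood can be a proper subset of it, so isolated vertices must go
     to [Rs] instead. *)
  have [k0|k_gt0] := posnP k.
    have U0 : U = set0 by apply: cards0_eq; rewrite Uk.
    exists U, (x |: Rs), v; split=> //.
    + by move=> z; rewrite inE lE U0 in_set0 in_setU1 /= orbA.
    + split=> //; first by rewrite U0 -setI_eq0 set0I.
      move=> z /setU1P[->|/Rsv//]; apply: contraNN xl; exact: vl.
    + split=> //; last by move=> a b _; rewrite U0 inE.
      have xRs a : a \in Rs -> ~~ adj x a by move=> aRs; apply: xN; rewrite lE aRs orbT.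
      apply/forall_inP => a /setU1P[->|aRs]; apply/forall_inP => b /setU1P[->|bRs].
      * by rewrite adj_irr.
      * exact: xRs.
      * by rewrite adjC xRs.
      * exact: (forall_inP (forall_inP Rsi a aRs)).
    + by split=> //; apply/set0Pn; exists x; rewrite setU11.
    + by split=> // y yv; rewrite nbE ?vl // vU.
  have nbx : nbr adj x :&: [set z in x :: l] = set0.
    apply/setP => z; rewrite !inE; case: eqVneq => [->|_] /=; first by rewrite adj_irr.
    by case: (boolP (z \in l)) => [/xN/negPf->|]; rewrite ?andbF.
  exists U, Rs, (rcons v x); split=> //.
  + by move=> z; rewrite mem_rcons !inE lE; case: eqP; rewrite ?orbT.
  + split=> // z zU; rewrite mem_rcons inE negb_or.
      by rewrite Uv // andbT; apply: contraNneq xl => <-; rewrite lE zU.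
    by rewrite Rsv // andbT; apply: contraNneq xl => <-; rewrite lE zU orbT.
  + split.
    * by rewrite rcons_uniq v_uniq andbT; apply: contraNN xl; exact: vl.
    * move=> y; rewrite mem_rcons inE => /predU1P[->|yv]; last by rewrite nbE ?vl // vU.
      by rewrite nbx properE sub0set subset0 -cards_eq0 Uk -lt0n.
    * case: (v) v_sorted' => //= y v' v'_sorted.
      by rewrite rcons_path v'_sorted nbx sub0set.
have [lE [URs Uv Rsv] [Ucl Rsi RsU] [Uk Rs0] [v_uniq vU v_sorted]] := H.
have nbE y : y \in l ->
    nbr adj y :&: [set z in x :: l] = x |: (nbr adj y :&: [set z in l]).
  move=> yl; apply/setP => z; rewrite !inE; case: eqVneq => [->|//] /=.
  by rewrite adjC xD.
have vl y : y \in v -> y \in l by move=> yv; rewrite lE yv !orbT.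
have xU : x \notin U by apply: contraNN xl; rewrite lE => ->.
exists (x |: U), Rs, v; split=> //.
+ by move=> z; rewrite !inE lE orbA.
+ split=> //; last by move=> z /setU1P[->|/Uv//]; apply: contraNN xl; exact: vl.
  rewrite -setI_eq0; apply/eqP/setP => z; rewrite !inE.
  case: eqVneq => [->|_] /=; first by apply/negP => xRs; move: xl; rewrite lE xRs orbT.
  by move/setP/(_ z): (disjoint_setI0 URs); rewrite !inE.
+ split=> //.
    have xUa a : a \in U -> adj x a by move=> aU; apply: xD; rewrite lE aU.
    apply/forall_inP => a /setU1P[->|aU]; apply/forall_inP => b /setU1P[->|bU]; apply/implyP => ab.
    * by rewrite eqxx in ab.
    * exact: xUa.
    * by rewrite adjC xUa.
    * by move/forall_inP/(_ a aU)/forall_inP/(_ b bU)/implyP/(_ ab): Ucl.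
  move=> a b aRs /setU1P[->|bU]; last exact: RsU.
  by rewrite adjC xD // lE aRs orbT.
+ by rewrite cardsU1 xU Uk.
split=> //.
  move=> y yv; rewrite nbE ?vl //; have /properP[nU [z zU zn]] := vU y yv.
  apply/properP; split; first by apply: setUS.
  exists z; first by rewrite !inE zU orbT.
  move: zn; rewrite !inE; case: eqVneq => [zx|//]; by rewrite -zx zU in xU.
apply: (sub_in_sorted (P := mem v)) v_sorted; last by apply/allP.
by move=> y z yv zv /=; rewrite !nbE ?vl // => yz; apply: setUS.
Qed.

Lemma dominating_count_in_family l k : (forall x, x \in l) ->
  dominating_count adj l k -> exists r s, (1 <= r)%N /\ in_family adj k r s.
Proof.
move=> lT /dominating_count_family_on[U [Rs [v]]].
case=> [lE [URs Uv Rsv] [Ucl Rsi RsU] [Uk Rs0] [v_uniq vU v_sorted]].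
have nbE x : nbr adj x :&: [set z in l] = nbr adj x.
  by apply/setP => z; rewrite !inE lT andbT.
exists #|Rs|, (size v); split; first by rewrite card_gt0.
exists U, Rs, [set z in v]; split.
- by apply/setP => z; rewrite !inE -orbA -lE lT.
- split=> //; rewrite -setI_eq0; apply/eqP/setP => z; rewrite !inE.
    by apply/andP => -[/Uv/negPf->].
  by apply/andP => -[/Rsv/negPf->].
- split=> //; apply/forall_inP => x; rewrite inE => xv; apply/forall_inP => y.
  rewrite inE => yv; apply/negP => xy.
  have /proper_sub/subsetP/(_ y) := vU x xv; rewrite nbE inE xy => /(_ isT)/Uv.
  by rewrite yv.
- by split=> //; rewrite cardsE; apply/card_uniqP.
split=> //; exists (in_tuple v); split=> //.
- by move=> z; rewrite inE.
- by move=> x xv; have := vU x xv; rewrite nbE.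
apply: sub_sorted v_sorted => x y; by rewrite !nbE.
Qed.

Section Family.
Variables (k r s : nat).
Hypotheses (r_gt0 : (0 < r)%N) (fam : in_family adj k r s).

(** The complement of [U] is independent, so a clique has at most one vertex there; [U] with any
    vertex of [Rs] attains the bound. *)
Lemma in_family_clique_number : clique_number adj = k.+1.
Proof.
have [U [Rs [S [UT _ [Ucl Rsi Si] [Uk Rsr _] [RsU [v [_ vS vU _]]]]]]] := fam.
have [x0 x0Rs] : exists x, x \in Rs by apply/set0Pn; rewrite -card_gt0 Rsr.
have adjU x y : x \notin U -> y \notin U -> ~~ adj x y.
  have cover z : z \notin U -> (z \in Rs) || (z \in S).
    by move=> /negPf zU; have := in_setT z; rewrite -UT !inE zU.
  have SU z t : z \in S -> t \notin U -> ~~ adj z t.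
    rewrite -vS => /vU/proper_sub/subsetP zU; apply: contraNN => zt.
    by apply: zU; rewrite inE.
  move=> xU yU; case/orP: (cover x xU) => [xR|/SU]; last exact.
  case/orP: (cover y yU) => [yR|/SU]; last by rewrite adjC; exact.
  exact: (forall_inP (forall_inP Rsi x xR)).
apply/eqP; rewrite eqn_leq; apply/andP; split.
  apply/bigmax_leqP => A Acl; rewrite -(cardsID U A) -addn1 leq_add //.
    by rewrite -Uk subset_leq_card // subsetIr.
  apply/card_le1_eqP => a b /setDP[aA aU] /setDP[bA bU]; apply/eqP.
  apply: contraNT (adjU a b aU bU); rewrite eq_sym => ab.
  by move/forall_inP/(_ a aA)/forall_inP/(_ b bA)/implyP/(_ ab): Acl.
have x0U : x0 \notin U.
  apply/negP => x0U; have := RsU x0 x0 x0Rs x0U; by rewrite adj_irr.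
have -> : k.+1 = #|x0 |: U| by rewrite cardsU1 x0U Uk.
apply: leq_bigmax_cond; apply/forall_inP => a /setU1P[->|aU];
  apply/forall_inP => b /setU1P[->|bU]; apply/implyP => ab.
- by rewrite eqxx in ab.
- exact: RsU.
- by rewrite adjC RsU.
- by move/forall_inP/(_ a aU)/forall_inP/(_ b bU)/implyP/(_ ab): Ucl.
Qed.

(** Every nonempty vertex set [D] contains a vertex dominating or isolated within it, so vertices
    can be removed one at a time. *)
Lemma in_family_threshold : threshold adj.
Proof.
have [U [Rs [S [UT _ [Ucl Rsi _] [_ Rsr _] [RsU [v [_ vS vU v_sorted]]]]]]] := fam.
have cover z : [|| z \in U, z \in Rs | z \in S].
  by have := in_setT z; rewrite -UT !inE orbA.
(* Along the listing inclusion follows position; comparing cardinalities instead makes the order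
   independent of ties. *)
have nested : {in S &, forall x y, (#|nbr adj x| <= #|nbr adj y|)%N ->
    nbr adj x \subset nbr adj y}.
  have sub_trans : transitive (fun x y => nbr adj y \subset nbr adj x).
    by move=> y x z yx zy; exact: subset_trans zy yx.
  have chain i j : (i <= j < size v)%N -> forall x0,
      nbr adj (nth x0 v j) \subset nbr adj (nth x0 v i).
    move=> /andP[ij jv] x0.
    have := sorted_leq_nth sub_trans (fun x => subxx _) x0 v_sorted.
    by move=> /(_ i j); rewrite !inE => -> //; exact: leq_ltn_trans ij jv.
  move=> x y; rewrite -!vS => xv yv xy.
  rewrite -(nth_index x xv) -(nth_index x yv).
  have [ij|ji] := leqP (index y v) (index x v).
    by apply: chain; rewrite ij index_mem.
  have : nbr adj y \subset nbr adj x.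
    rewrite -(nth_index x xv) -(nth_index x yv).
    by apply: chain; rewrite (ltnW ji) index_mem.
  by rewrite !nth_index // => yx; have := eqEcard (nbr adj y) (nbr adj x);
    rewrite yx xy => /eqP->.
suff peel m (D : {set T}) : #|D| = m.+1 -> exists l, threshold_seq adj l /\ l =i D.
  have [x0 _] : exists x, x \in Rs by apply/set0Pn; rewrite -card_gt0 Rsr.
  have T0 : #|[set: T]| = #|[set: T]|.-1.+1.
    by rewrite prednK //; apply/card_gt0P; exists x0.
  have [l [lthr lT]] := peel _ _ T0.
  by exists l; split=> // x; rewrite lT inE.
elim: m D => [|m IHm] D Dm.
  have /cards1P[x ->] : #|D| == 1 by rewrite Dm.
  by exists [:: x]; split; [constructor|move=> z; rewrite !inE].
suff [x xD [xadj|xiso]] : exists2 x, x \in D &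
    {in D, forall y, y != x -> adj x y} \/ {in D, forall y, y != x -> ~~ adj x y}.
- have [|l [lthr lD]] := IHm (D :\ x).
    by apply/eqP; rewrite -eqSS -Dm (cardsD1 x D) xD.
  exists (x :: l); split; last first.
    by move=> z; rewrite inE lD !inE; case: eqVneq => [->|].
  apply: threshold_dominating => //; first by rewrite lD setD11.
  by move=> y; rewrite lD => /setD1P[yx yD]; exact: xadj.
- have [|l [lthr lD]] := IHm (D :\ x).
    by apply/eqP; rewrite -eqSS -Dm (cardsD1 x D) xD.
  exists (x :: l); split; last first.
    by move=> z; rewrite inE lD !inE; case: eqVneq => [->|].
  apply: threshold_isolated => //; first by rewrite lD setD11.
  by move=> y; rewrite lD => /setD1P[yx yD]; exact: xiso.
have Uadj u z : u \in U -> z != u -> z \in U :|: Rs -> adj u z.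
  move=> uU zu /setUP[zU|zR]; last by rewrite adjC RsU.
  move/forall_inP/(_ u uU)/forall_inP/(_ z zU)/implyP: Ucl; apply.
  by rewrite eq_sym.
have [DS0|[x1 x1DS]] := set_0Vmem (D :&: S).
  have DUR z : z \in D -> z \in U :|: Rs.
    move=> zD; have := cover z; rewrite inE orbA => /orP[//|zS].
    by have := in_set0 z; rewrite -DS0 inE zD zS.
  have [DU0|[u /setIP[uD uU]]] := set_0Vmem (D :&: U).
    have DR z : z \in D -> z \in Rs.
      move=> zD; have /setUP[zU|//] := DUR z zD.
      by have := in_set0 z; rewrite -DU0 inE zD zU.
    have /card_gt0P[x xD] : (0 < #|D|)%N by rewrite Dm.
    exists x => //; right=> y yD _.
    exact: (forall_inP (forall_inP Rsi x (DR x xD)) y (DR y yD)).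
  by exists u => //; left=> y yD yu; apply: Uadj => //; exact: DUR.
(* The vertex [x] of [D :&: S] with the smallest neighbourhood is either isolated in [D] or has a
   neighbour [u] there. By nesting, [u] is then adjacent to all of [D :&: S], hence dominates
   [D]. *)
case: (@arg_minnP _ x1 (mem (D :&: S)) (fun x => #|nbr adj x|) x1DS) => x xDS' xmin.
have /setIP[xD xS] : x \in D :&: S by [].
have [xD0|[u /setIP[uN uD]]] := set_0Vmem (nbr adj x :&: D).
  exists x => //; right=> y yD _; apply/negP => xy.
  by have := in_set0 y; rewrite -xD0 !inE xy yD.
have uU : u \in U by apply: (subsetP (proper_sub (vU x _))) uN; rewrite vS.
exists u => //; left=> y yD yu; have := cover y; rewrite orbA => /orP[yUR|yS].
  by apply: Uadj; rewrite // inE.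
have /subsetP/(_ u uN) : nbr adj x \subset nbr adj y.
  by apply: nested => //; apply: xmin; rewrite /= inE yD yS.
by rewrite inE adjC.
Qed.
End Family.
End Combinatorics.

Local Open Scope ring_scope.

(** * Laplacians *)

Lemma sum_enum_rank (R : realType) (T : finType) (F : 'I_#|T| -> R) :
  \sum_i F i = \sum_x F (enum_rank x).
Proof. by rewrite (reindex enum_rank) //; apply/onW_bij/enum_rank_bij. Qed.

(** Handshake count: each edge is the image of exactly two ordered adjacent pairs. *)
Lemma sum_adj_edges (R : realType) (T : finType) (adj : rel T) :
  symmetric adj -> irreflexive adj ->
  \sum_x \sum_y (adj x y)%:R = 2 * #|edges adj|%:R :> R.
Proof.
move=> adjC adj_irr.
have E : (\sum_x \sum_y (adj x y) = 2 * #|edges adj|)%N.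
  rewrite pair_bigA /=.
  rewrite (eq_bigr (fun p => if adj p.1 p.2 then 1%N else 0%N)); last first.
    by move=> p _; case: (adj _ _).
  rewrite -big_mkcond /=.
  rewrite (partition_big (fun p : T * T => [set p.1; p.2]) (mem (edges adj))) /=; last first.
    move=> [x y] /= xy; rewrite inE; apply/existsP; exists x; apply/existsP; exists y.
    by rewrite xy eqxx.
  rewrite mulnC -sum_nat_const; apply: eq_bigr => e.
  rewrite inE => /existsP[x /existsP[y /andP[xy /eqP ->]]].
  have x_neq_y : x != y by apply: contraTneq xy => ->; rewrite adj_irr.
  rewrite (eq_bigl (mem [set (x, y); (y, x)])) => [|[a b]].
    rewrite sum1_card cards2 (_ : (x, y) != (y, x)) //.
    by apply: contra x_neq_y => /eqP[->].
  rewrite !inE /= !xpair_eqE; apply/andP/orP => [[ab /eqP/setP abE]|].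
    have := abE a; have := abE b; have := abE x; have := abE y.
    rewrite !inE !eqxx /= ?orbT /=.
    have a_neq_b : a != b by apply: contraTneq ab => ->; rewrite adj_irr.
    move=> _ _ /esym/orP[]/eqP bE /esym/orP[]/eqP aE; subst a b.
    - by rewrite eqxx in a_neq_b.
    - by right; rewrite !eqxx.
    - by left; rewrite !eqxx.
    - by rewrite eqxx in a_neq_b.
  case=> /andP[/eqP-> /eqP->]; rewrite ?xy ?eqxx //.
  by rewrite adjC xy setUC eqxx.
rewrite -natrM -E natr_sum; apply: eq_bigr => x _.
by rewrite natr_sum.
Qed.

Section Laplacian.
Variables (R : realType) (T : finType) (adj : rel T).
Hypotheses (adjC : symmetric adj) (adj_irr : irreflexive adj).
Let L := laplacian R adj.

Definition kernel_of_mx (P : 'M[R]_#|T|) (x y : T) : R :=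
  P (enum_rank x) (enum_rank y).

Lemma laplacian_trace (P : 'M[R]_#|T|) : P^T = P ->
  2 * \tr (P *m L) =
  \sum_x \sum_y (adj x y)%:R * sqdist (kernel_of_mx P) x y.
Proof.
move=> symP; set c := kernel_of_mx P.
have cC x y : c x y = c y x by rewrite /c /kernel_of_mx -{1}symP mxE.
have trE : \tr (P *m L) = \sum_x \sum_y (adj x y)%:R * (c x x - c x y).
  rewrite /mxtrace sum_enum_rank; apply: eq_bigr => x _.
  rewrite mxE sum_enum_rank.
  under eq_bigr do rewrite !mxE !enum_rankK (inj_eq enum_rank_inj) mulrBr.
  rewrite sumrB (bigD1 x) //= eqxx mulr1n [X in _ + X - _]big1 ?addr0; last first.
    by move=> y /negPf->; rewrite mulr0n mulr0.
  under [RHS]eq_bigr do rewrite mulrBr.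
  rewrite sumrB -mulr_suml mulrC; congr (_ * _ - _).
    rewrite -sum1_card natr_sum big_mkcond /=; apply: eq_bigr => y _.
    by rewrite inE; case: (adj _ _).
  by apply: eq_bigr => y _; rewrite adjC mulrC.
rewrite mulr_natl mulr2n {2}trE exchange_big /= trE -big_split /=.
apply: eq_bigr => x _; rewrite -big_split /=; apply: eq_bigr => y _.
by rewrite (adjC y x) /sqdist (cC y x); ring.
Qed.

Lemma laplacian_row_sum : (const_mx 1 : 'rV_#|T|) *m L = 0.
Proof.
apply/rowP => j; rewrite !mxE sum_enum_rank -[j]enum_valK; set y := enum_val j.
under eq_bigr do rewrite !mxE mul1r !enum_rankK (inj_eq enum_rank_inj).
rewrite sumrB (bigD1 y) //= eqxx mulr1n [X in _ + X - _]big1 ?addr0; last first.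
  by move=> x /negPf->; rewrite mulr0n.
apply/eqP; rewrite subr_eq0; apply/eqP.
rewrite -sum1_card natr_sum big_mkcond /=; apply: eq_bigr => x _.
by rewrite inE adjC; case: (adj _ _).
Qed.

(** For the rank-one matrix [v^T *m v] the trace formula becomes a sum of squares of differences
    over the edges. *)
Lemma laplacian_psd (v : 'rV_#|T|) : 0 <= (v *m L *m v^T) 0 0.
Proof.
have : 0 <= 2 * \tr (v^T *m v *m L).
  rewrite laplacian_trace ?trmx_mul ?trmxK // sumr_ge0 // => x _.
  rewrite sumr_ge0 // => y _; rewrite mulr_ge0 ?ler0n //.
  rewrite /sqdist /kernel_of_mx !mxE !big_ord1 !mxE.
  set a := v 0 _; set b := v 0 _.
  have -> : a * a + b * b - 2 * (a * b) = (a - b) ^+ 2 by ring.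
  exact: sqr_ge0.
rewrite pmulr_rge0 // -mulmxA mxtrace_mulC.
by rewrite [X in \tr X]mx11_scalar mxtrace_scalar mulr1n.
Qed.

Lemma centered_proj_kernel (P : 'M[R]_#|T|) :
  P^T = P -> P *m P = P -> P *m const_mx 1 = 0 :> 'cV_#|T| ->
  centered_proj (kernel_of_mx P).
Proof.
move=> symP PP P1; split=> [x y|x y|x].
- by rewrite /kernel_of_mx -{1}symP mxE.
- rewrite /kernel_of_mx -[in RHS]PP mxE sum_enum_rank //.
have := congr1 (fun M : 'cV_#|T| => M (enum_rank x) 0) P1; rewrite !mxE => e.
rewrite -[RHS]e sum_enum_rank; apply: eq_bigr => y _.
by rewrite mxE mulr1.
Qed.

Definition mx_of_kernel (c : T -> T -> R) : 'M[R]_#|T| :=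
  \matrix_(i, j) c (enum_val i) (enum_val j).

Lemma kernel_of_mxK c x y : kernel_of_mx (mx_of_kernel c) x y = c x y.
Proof. by rewrite /kernel_of_mx mxE !enum_rankK. Qed.

Lemma bin2_double k : 2 * 'C(k.+1, 2)%:R = k%:R ^+ 2 + k%:R :> R.
Proof.
rewrite -natrM mulnC bin2 muln2 halfK oddM /= andNb subn0.
by rewrite natrM -natr1; ring.
Qed.

Lemma sum_adj_sqdist (c : T -> T -> R) :
  \sum_x \sum_y (adj x y)%:R * (sqdist c x y - 1) =
  \sum_x \sum_y (adj x y)%:R * sqdist c x y - 2 * #|edges adj|%:R.
Proof.
rewrite -sum_adj_edges // -sumrB; apply: eq_bigr => x _.
by rewrite -sumrB; apply: eq_bigr => y _; rewrite mulrBr mulr1.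
Qed.

(** * Brouwer's inequality and its equality case *)

(** The deviation inequality for the projection onto top eigenvectors. The factor 2 comes from
    summing over ordered pairs. *)
Lemma laplacian_sum_deviation k : (0 < k < #|T|)%N ->
  exists c : T -> T -> R, [/\ centered_proj c, \sum_x c x x = k%:R &
    \sum_x \sum_y deviation adj c x y ^+ 2 <=
    2 * (#|edges adj|%:R + 'C(k.+1, 2)%:R - laplacian_sum R adj k)].
Proof.
move=> k_bounds.
have [[P [symP PP P1 trP sumP]] _] := top_eigenvalue_sum (laplacian_sym R adjC)
  laplacian_row_sum laplacian_psd k_bounds.
have cP := centered_proj_kernel symP PP P1.
have ck : \sum_x kernel_of_mx P x x = k%:R by rewrite -trP /mxtrace sum_enum_rank.
exists (kernel_of_mx P); split=> //; apply: le_trans (sum_deviation_le adjC cP) _.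
rewrite ck sum_adj_sqdist -laplacian_trace // sumP -/(laplacian_sum R adj k).
by rewrite !mulrDr bin2_double; lra.
Qed.

Lemma brouwer_bound k : (0 < k < #|T|)%N ->
  laplacian_sum R adj k <= #|edges adj|%:R + 'C(k.+1, 2)%:R.
Proof.
move=> /laplacian_sum_deviation[c [_ _]].
have : 0 <= \sum_x \sum_y deviation adj c x y ^+ 2.
  by rewrite sumr_ge0 // => x _; rewrite sumr_ge0 // => y _; exact: sqr_ge0.
move=> h1 h2; have := le_trans h1 h2; rewrite pmulr_rge0 // subr_ge0 //.
Qed.

Lemma laplacian_sum_all : laplacian_sum R adj #|T| = 2 * #|edges adj|%:R.
Proof.
rewrite /laplacian_sum sum_eigenvalues ?laplacian_sym // /mxtrace sum_enum_rank.
rewrite -sum_adj_edges //; apply: eq_bigr => x _.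
rewrite !mxE eqxx mulr1n enum_rankK adj_irr subr0 -sum1_card natr_sum big_mkcond /=.
by apply: eq_bigr => y _; rewrite inE; case: (adj _ _).
Qed.

Lemma edges_le : 2 * #|edges adj|%:R <= #|T|%:R ^+ 2 :> R.
Proof.
rewrite -sum_adj_edges //.
have -> : #|T|%:R ^+ 2 = \sum_(x : T) \sum_(y : T) 1 :> R.
  by rewrite !sumr_const expr2 mulr_natr.
by apply: ler_sum => x _; apply: ler_sum => y _; rewrite lern1; case: (adj _ _).
Qed.

Lemma tight_laplacian_sum k : (0 < k <= #|T|)%N ->
  laplacian_sum R adj k = #|edges adj|%:R + 'C(k.+1, 2)%:R ->
  exists l, dominating_count adj l k /\ forall x, x \in l.
Proof.
move=> /andP[k_gt0]; rewrite leq_eqVlt => /orP[/eqP k_eq|k_lt].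
  (* For [k = #|T|] the sum is twice the number of edges, so equality would make that number
     ['C(n + 1, 2)], above the crude bound [n ^ 2 / 2]. *)
  rewrite k_eq laplacian_sum_all => e; have := edges_le; have := bin2_double #|T|.
  have n_gt0 : 0 < #|T|%:R :> R by rewrite ltr0n -k_eq.
  by move=> e2 e3; exfalso; clear k_gt0 k_eq; lra.
move=> sumE; have [|c [cP ck]] := @laplacian_sum_deviation k; first by rewrite k_gt0.
rewrite sumE subrr mulr0 => dev_le.
have dev_ge0 x : 0 <= \sum_y deviation adj c x y ^+ 2.
  by rewrite sumr_ge0 // => y _; exact: sqr_ge0.
have dev0 x y : deviation adj c x y = 0.
  have sum0 : \sum_x \sum_y deviation adj c x y ^+ 2 = 0.
    by apply/eqP; rewrite eq_le dev_le sumr_ge0.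
  have row0 : \sum_y deviation adj c x y ^+ 2 = 0.
    exact: psumr_eq0P (fun x _ => dev_ge0 x) sum0 x isT.
  apply/eqP; rewrite -sqrf_eq0; apply/eqP.
  exact: psumr_eq0P (fun y _ => sqr_ge0 _) row0 y isT.
have [c_sym c_idem c1] := cP.
have sumT (F : T -> R) : \sum_(x in [set: T]) F x = \sum_x F x.
  by apply: eq_bigl => x; rewrite inE.
have [||||||| l ld lT] := @tight_dominating_count R T adj setT c k.
- by rewrite -card_gt0 cardsT; exact: leq_ltn_trans k_lt.
- by move=> x y _ _.
- by move=> x y _ _; rewrite sumT.
- by move=> x _; rewrite sumT.
- by rewrite sumT.
- by move=> x y _ _ _ xy; have := dev0 x y; rewrite /deviation xy; lra.
- move=> x y _ _ _ xy; have := dev0 x y; rewrite /deviation (negPf xy); lra.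
by exists l; split=> // x; rewrite lT inE.
Qed.

Lemma dominating_count_uniq l k : dominating_count adj l k -> uniq l /\ (k < size l)%N.
Proof. by elim=> {l k} [x|x l k _ [ul kl] xl _|x l k _ [ul kl] xl _] //=;
  rewrite xl ul //; split=> //; exact: leqW. Qed.

(** The upper bound is Brouwer's inequality; the lower bound tests the variational principle on the
    explicit projection of [dominating_count_proj]. *)
Lemma dominating_count_laplacian_sum l k : (0 < k)%N ->
  dominating_count adj l k -> (forall x, x \in l) ->
  laplacian_sum R adj k = #|edges adj|%:R + 'C(k.+1, 2)%:R.
Proof.
move=> k_gt0 ld lT; have [l_uniq k_size] := dominating_count_uniq ld.
have k_lt : (k < #|T|)%N.
  apply: leq_trans k_size _; rewrite -(card_uniqP l_uniq); exact: max_card.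
have k_bounds : (0 < k < #|T|)%N by rewrite k_gt0.
have [c [cP _ ck]] := dominating_count_proj R adjC adj_irr ld.
have sumT (F : T -> R) : \sum_(x in l) F x = \sum_x F x.
  by apply: eq_bigl => x; rewrite lT.
rewrite sumT; under eq_bigr do rewrite sumT; rewrite sum_adj_sqdist => cE.
have [c_sym c_idem c1] := cP; pose P := mx_of_kernel c.
have symP : P^T = P by apply/matrixP => i j; rewrite !mxE.
have [_ top_le] := top_eigenvalue_sum (laplacian_sym R adjC)
  laplacian_row_sum laplacian_psd k_bounds.
apply/eqP; rewrite eq_le brouwer_bound //=.
have := top_le P symP _ _ _; rewrite -/(laplacian_sum R adj k).
have -> : \tr (P *m L) = #|edges adj|%:R + 'C(k.+1, 2)%:R.
  apply: (@mulfI _ 2); first by rewrite pnatr_eq0.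
  rewrite laplacian_trace // mulrDr bin2_double -cE.
  rewrite [RHS]addrC subrK; apply: eq_bigr => x _; apply: eq_bigr => y _.
  by rewrite /sqdist !kernel_of_mxK.
apply.
- apply/matrixP => i j; rewrite !mxE sum_enum_rank -[RHS]c_idem.
  by apply: eq_bigr => z _; rewrite !mxE enum_rankK.
- apply/matrixP => i j; rewrite !mxE sum_enum_rank -[RHS](c1 (enum_val i)).
  by apply: eq_bigr => z _; rewrite !mxE enum_rankK mulr1.
by rewrite /mxtrace sum_enum_rank -ck; apply: eq_bigr => x _; rewrite mxE enum_rankK.
Qed.
End Laplacian.

Theorem mainTheorem1 (R : realType) (T : finType) (adj : rel T)
    (adj_sym : symmetric adj) (adj_irr : irreflexive adj)
    (k : nat) (k_gt0 : (1 <= k)%N) (k_le_n : (k <= #|T|)%N) :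
  (laplacian_sum R adj k = #|edges adj|%:R + 'C(k.+1, 2)%:R
   <-> exists r s : nat, (1 <= r)%N /\ in_family adj k r s)
  /\
  (laplacian_sum R adj k = #|edges adj|%:R + 'C(k.+1, 2)%:R
   <-> threshold adj /\ clique_number adj = k.+1).
Proof.
have eq_family : laplacian_sum R adj k = #|edges adj|%:R + 'C(k.+1, 2)%:R ->
    exists r s : nat, (1 <= r)%N /\ in_family adj k r s.
  move=> /(tight_laplacian_sum adj_sym adj_irr) [|l [ld lT]].
    by rewrite k_gt0.
  exact: dominating_count_in_family lT ld.
have family_threshold : (exists r s : nat, (1 <= r)%N /\ in_family adj k r s) ->
    threshold adj /\ clique_number adj = k.+1.
  move=> [r [s [r_gt0 fam]]].
  by split; [exact: in_family_threshold fam|exact: in_family_clique_number fam].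
have threshold_eq : threshold adj /\ clique_number adj = k.+1 ->
    laplacian_sum R adj k = #|edges adj|%:R + 'C(k.+1, 2)%:R.
  move=> [[l [/threshold_seq_dominating_count[k' ld] lT]] clique_k].
  have [r [s [r_gt0 fam]]] := dominating_count_in_family adj_sym adj_irr lT ld.
  (* The number of dominating steps is recovered from the clique number, which identifies [k'] with
     [k]. *)
  have [k'k] : k'.+1 = k.+1.
    by rewrite -clique_k (in_family_clique_number adj_sym adj_irr r_gt0 fam).
  by apply: dominating_count_laplacian_sum lT => //; rewrite -k'k.
split; split.
- exact: eq_family.
- by move/family_threshold/threshold_eq.
- by move/eq_family/family_threshold.
- exact: threshold_eq.
Qed.
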